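(* Let $(X,f)$ be a dynamical system with $f$ Lipschitz, and suppose there are a non-empty compact set $Y\subseteq X$ and a positive integer $N$ such that $f^N(Y)=Y$, $X=\bigcup_{l=0}^{N-1}f^l(Y)$, and $(Y,f^N)$ has the exponential non-uniform specification property with respect to the exponent $(N\lambda_1,N\lambda_2)$ at some scale $\varepsilon_0>0$. For each $j\ge1$ let $\varphi_j:\mathbb N\to(0,1]$ be a map, $\mathcal Z_j=\{z_j^i\}_{i=0}^\infty\subset X$ a sequence of points, and $S_j=\{s_j^i\}_{i=0}^\infty\subset\mathbb N$ a sequence of positive integers with $\lim_{i\to\infty}s_j^i=\infty$. Put $\overline\tau_j:=\limsup_{n\to\infty}-\frac{\ln\varphi_j(n)}{n}$ and $\overline\tau:=\sup_{j\ge1}\overline\tau_j$. If $\overline\tau<\lambda_1$ and $\bigcap_{j=1}^\infty\mathrm{Ind}'(\mathcal Z_j,S_j,Y)\ne\emptyset$, then $\bigcap_{j=1}^\infty\mathfrak S(f,\varphi_j,\mathcal Z_j,S_j)$ is non-empty and $$h_{top}\Big(f,\bigcap_{j=1}^\infty\mathfrak S(f,\varphi_j,\mathcal Z_j,S_j)\Big)\ge\frac{\lambda_1\lambda_2-\lambda_2\overline\tau}{\lambda_1\lambda_2+\lambda_1\overline\tau}\,h_{top}(f,X).$$ Moreover: (1) if further $f:X\to X$ is an $L$-Lipschitz map, then $$\dim_H\bigcap_{j=1}^\infty\mathfrak S(f,\varphi_j,\mathcal Z_j,S_j)\ge\frac1{\ln L}\,\frac{\lambda_1\lambda_2-\lambda_2\overline\tau}{\lambda_1\lambda_2+\lambda_1\overline\tau}\,h_{top}(f,X);$$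 (2) if further $f:X\to X$ is an $(L_1,L_2)$-bi-Lipschitz homeomorphism, then $$\dim_H\bigcap_{j=1}^\infty\mathfrak S(f,\varphi_j,\mathcal Z_j,S_j)\ge\Big(\frac1{\ln L_1}+\frac1{\ln L_2}\,\frac{\lambda_1\lambda_2-\lambda_2\overline\tau}{\lambda_1\lambda_2+\lambda_1\overline\tau}\Big)h_{top}(f,X).$$
   Context: $\mathbb N$ is the set of non-negative integers. A dynamical system $(X,f)$ consists of a compact metric space $(X,d)$ with at least two points and a continuous map $f:X\to X$. Shrinking target set: for $\varphi:\mathbb N\to(0,\infty)$, $\mathcal Z=\{z_i\}_{i=0}^\infty\subset X$ and $S\subset\mathbb N$, $\mathfrak S(f,\varphi,\mathcal Z,S):=\{x\in X: d(f^n(x),z_n)<\varphi(n)\text{ for infinitely many }n\in S\}$. For $\mathcal Z_j=\{z_j^i\}_{i\ge0}$ the target centre at time $n$ is $z_j^n$. Index sets: given $Y$ and $N$ with $f^N(Y)=Y$ and $X=\bigcup_{l=0}^{N-1}f^l(Y)$, a sequence $\mathcal Z=\{z_i\}_{i=0}^\infty\subset X$ and a sequence of positive integers $S=\{s_i\}_{i=0}^\infty$ with $s_i\to\infty$, let $\mathrm{Ind}(\mathcal Z,S,Y)$ be the set of $(I_1,I_2)\in\{0,1,\dots,N-1\}^2$ such that there are infinitely many $i$ with $z_{s_i}\in f^{I_1}(Y)$ and $N\mid(s_i-I_2)$; and $\mathrm{Ind}'(\mathcal Z,S,Y):=\{I_1-I_2:(I_1,I_2)\in\mathrm{Ind}(\mathcal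 Z,S,Y)\}$. Lipschitz conditions: $f$ is $L$-Lipschitz if $\sup_{x\ne y}\frac{d(f(x),f(y))}{d(x,y)}\le L<\infty$ (and Lipschitz if this holds for some $L$). $f$ is an $(L_1,L_2)$-bi-Lipschitz homeomorphism if it is a homeomorphism with $\sup_{x\neq y}\frac{d(f^{-1}(x),f^{-1}(y))}{d(x,y)}\le L_1<\infty$ and $\sup_{x\neq y}\frac{d(f(x),f(y))}{d(x,y)}\le L_2<\infty$. For a system $(W,g)$, the exponential Bowen ball is $B_n(x,\varepsilon,\lambda_1,\lambda_2,g):=\{y\in W: d(g^i(x),g^i(y))<\varepsilon e^{-\min\{i\lambda_1,(n-1-i)\lambda_2\}}\text{ for all }0\le i\le n-1\}$, where $n\ge1$ and $\varepsilon,\lambda_1,\lambda_2>0$. $(W,g)$ has the exponential non-uniform specification property with respect to the exponent $(\lambda_1,\lambda_2)$ at scale $\varepsilon$ if for every $n\ge1$ there is a positive integer $p(n,\varepsilon)$ with $\limsup_{n\to\infty}\frac1n p(n,\varepsilon)=0$ such that: for any points $x_1,\dots,x_k\in W$, positive integers $n_1,\dots,n_k$, and $p_i\ge p(n_i,\varepsilon)$, there is $z\in W$ with $z\in B_{n_1}(x_1,\varepsilon,\lambda_1,\lambda_2,g)$ and $g^{n_1+p_1+\cdots+n_{i-1}+p_{i-1}}(z)\in B_{n_i}(x_i,\varepsilon,\lambda_1,\lambda_2,g)$ for every $2\le i\le k$. Bowen topological entropy of a subset $Z\subseteq X$: let $B_n(x,\varepsilon,f)=\{y: d(f^i(x),f^i(y))<\varepsilon,\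 0\le i\le n-1\}$. For $s\ge0$, $M\ge 1$, $\varepsilon>0$ let $\mathcal M^s_{M,\varepsilon}(Z)=\inf\sum_i e^{-sn_i}$ over finite or countable families $\{B_{n_i}(x_i,\varepsilon,f)\}$ covering $Z$ with $x_i\in X$, $n_i\ge M$; $\mathcal M^s_\varepsilon(Z)=\lim_{M\to\infty}\mathcal M^s_{M,\varepsilon}(Z)$; $h_{top}(f,Z,\varepsilon)=\inf\{s:\mathcal M^s_\varepsilon(Z)=0\}$; $h_{top}(f,Z)=\lim_{\varepsilon\to0}h_{top}(f,Z,\varepsilon)$. For $Z=X$ this is the classical topological entropy. $\dim_H$ is Hausdorff dimension with respect to $d$. *)

(* Defs.v *)
From HB Require Import structures.
From mathcomp Require Import all_boot all_order all_algebra.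
From mathcomp Require Import all_classical all_reals all_analysis.

Set Implicit Arguments.
Unset Strict Implicit.
Unset Printing Implicit Defensive.

Import Order.TTheory GRing.Theory Num.Theory.
Import numFieldNormedType.Exports.

Local Open Scope classical_set_scope.
Local Open Scope ring_scope.

Definition dynamical_system (R : realType) (X : metricType R) (f : X -> X) :
    Prop :=
  [/\ compact [set: X], exists x y : X, x <> y & continuous f].

Definition shrinking_target (R : realType) (X : metricType R) (f : X -> X)
    (phi : nat -> R) (z : nat -> X) (S : set nat) : set X :=
  [set x | infinite_set [set n | S n /\ mdist (iter n f x) (z n) < phi n]].

(* The difference s i - I2 and the elements of Ind' may be negative, hence the
   integer divisibility. *)
Definition Ind (R : realType) (X : metricType R) (f : X -> X) (N : nat)
    (z : nat -> X) (s : nat -> nat) (Y : set X) : set (nat * nat) :=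
  [set I | [/\ (I.1 < N)%N, (I.2 < N)%N &
    infinite_set [set i | (iter I.1 f @` Y) (z (s i)) /\
                          (N%:Z %| (s i)%:Z - I.2%:Z)%Z]]].

Definition Ind' (R : realType) (X : metricType R) (f : X -> X) (N : nat)
    (z : nat -> X) (s : nat -> nat) (Y : set X) : set int :=
  [set I.1%:Z - I.2%:Z | I in Ind f N z s Y].

Definition lipschitz_const (R : realType) (X : metricType R) (f : X -> X) :
    \bar R :=
  ereal_sup [set (mdist (f p.1) (f p.2) / mdist p.1 p.2)%:E |
             p in [set p : X * X | p.1 <> p.2]].

Definition lipschitz_with (R : realType) (X : metricType R) (L : R)
    (f : X -> X) : Prop :=
  (lipschitz_const f <= L%:E)%E.

Definition bilipschitz_homeo (R : realType) (X : metricType R) (L1 L2 : R)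
    (f : X -> X) : Prop :=
  exists g : X -> X,
    [/\ cancel f g /\ cancel g f, continuous f, continuous g,
        lipschitz_with L1 g & lipschitz_with L2 f].

Definition exp_bowen_ball (R : realType) (X : metricType R) (W : set X)
    (n : nat) (x : X) (eps l1 l2 : R) (g : X -> X) : set X :=
  [set y | W y /\ forall i, (i < n)%N ->
    mdist (iter i g x) (iter i g y) <
      eps * expR (- Num.min (i%:R * l1) ((n%:R - 1 - i%:R) * l2))].

(* The system is the restriction of g to an invariant set W. The data
   (x_i, n_i, p_i), 1 <= i <= k, are the values at 0, ..., k - 1 of the
   sequences x, n, q, and the empty sum for i = 0 gives the condition on z
   itself. *)
Definition exp_specification (R : realType) (X : metricType R) (W : set X)
    (g : X -> X) (l1 l2 eps : R) : Prop :=
  exists p : nat -> nat,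
    [/\ forall n, (0 < n)%N -> (0 < p n)%N,
        limn_esup (fun n => ((p n)%:R / n%:R : R)%:E) = 0%E &
        forall (k : nat) (x : nat -> X) (n q : nat -> nat),
          (0 < k)%N ->
          (forall i, (i < k)%N ->
             [/\ W (x i), (0 < n i)%N & (p (n i) <= q i)%N]) ->
          exists z : X, W z /\
            forall i, (i < k)%N ->
              exp_bowen_ball W (n i) (x i) eps l1 l2 g
                (iter (\sum_(j < i) (n j + q j))%N g z)].

Definition bowen_ball (R : realType) (X : metricType R) (n : nat) (x : X)
    (eps : R) (f : X -> X) : set X :=
  [set y | forall i, (i < n)%N -> mdist (iter i f x) (iter i f y) < eps].

(* Finite or countable families are indexed by an arbitrary subset D of nat. *)
Definition bowen_outer (R : realType) (X : metricType R) (f : X -> X)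
    (s : R) (M : nat) (eps : R) (Z : set X) : \bar R :=
  ereal_inf [set v | exists (D : set nat) (x : nat -> X) (n : nat -> nat),
    [/\ forall i, D i -> (M <= n i)%N,
        Z `<=` \bigcup_(i in D) bowen_ball (n i) (x i) eps f &
        v = (\esum_(i in D) (expR (- s * (n i)%:R))%:E)%E]].

Definition bowen_measure (R : realType) (X : metricType R) (f : X -> X)
    (s eps : R) (Z : set X) : \bar R :=
  limn (fun M => bowen_outer f s M eps Z).

Definition htop_scale (R : realType) (X : metricType R) (f : X -> X)
    (Z : set X) (eps : R) : \bar R :=
  ereal_inf [set s%:E | s in [set s : R | 0 <= s /\
                                          bowen_measure f s eps Z = 0%E]].

Definition htop (R : realType) (X : metricType R) (f : X -> X) (Z : set X) :
    \bar R :=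
  lim (htop_scale f Z eps @[eps --> (0 : R)^'+]).

(* The point 0 only serves to give the empty set diameter 0. *)
Definition diam (R : realType) (X : metricType R) (U : set X) : \bar R :=
  ereal_sup (0%E |` [set (mdist p.1 p.2)%:E | p in U `*` U]).

(* As for Bowen covers, the cover is indexed by a subset of nat. With s = 0
   every member of the cover counts 1, since 0 `^ 0 = 1. *)
Definition hausdorff_outer (R : realType) (X : metricType R)
    (s delta : R) (A : set X) : \bar R :=
  ereal_inf [set v | exists (D : set nat) (U : nat -> set X),
    [/\ forall i, D i -> (diam (U i) <= delta%:E)%E,
        A `<=` \bigcup_(i in D) U i &
        v = (\esum_(i in D) (diam (U i) `^ s))%E]].

Definition hausdorff_measure (R : realType) (X : metricType R)
    (s : R) (A : set X) : \bar R :=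
  lim (hausdorff_outer s delta A @[delta --> (0 : R)^'+]).

Definition hausdorff_dim (R : realType) (X : metricType R) (A : set X) :
    \bar R :=
  ereal_inf [set s%:E | s in [set s : R | 0 <= s /\
                                          hausdorff_measure s A = 0%E]].

Definition upper_rate (R : realType) (phi : nat -> R) : \bar R :=
  limn_esup (fun n => (- (ln (phi n) / n%:R))%:E).

Definition entropy_factor (R : realType) (l1 l2 tau : R) : R :=
  (l1 * l2 - l2 * tau) / (l1 * l2 + l1 * tau).

(* Main.v *)
(** The points of the target set are built by specification for [g = f^N]
    on [Y]. To hit a target at time [n] with accuracy [exp (- tau n)] one
    shadows an orbit segment from time about [n (1 - tau / l1)] to time about
    [n (1 + tau / l2)]; all the other time is filled with free blocks, each
    chosen among [exp (h * length)] separated ones, where [h] is close to the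
    entropy of [f]. With sparse targets the worst ratio of free time to total
    time is reached at the end of a target segment, and it is
    [(1 - tau / l1) / (1 + tau / l2) = entropy_factor l1 l2 tau].

    The choices of blocks form a product tree carrying its uniform measure. A
    Bowen ball of length [n], or a set of diameter [d], meets only one cylinder,
    of mass at most about [exp (- r n)], with [n = ln (1 / d) / ln L] in the
    second case, which bounds the sums over covers from below. If [f] is
    invertible, the time before 0 is filled with free blocks as well, and a set
    of diameter [d] determines about [ln (1 / d) / ln L1] units of it. *)

Require Import Defs.
From HB Require Import structures.
From mathcomp Require Import all_boot all_order all_algebra.
From mathcomp Require Import all_classical all_reals all_analysis.
From mathcomp Require Import zify ring lra.

Set Implicit Arguments.
Unset Strict Implicit.
Unset Printing Implicit Defensive.

Import Order.TTheory GRing.Theory Num.Theory.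
Import numFieldNormedType.Exports.

Local Open Scope classical_set_scope.
Local Open Scope ring_scope.

(** * Covers by cylinders *)

(** Letters are chosen one at a time so that the total conditional measure of the cylinders stays
    below 1. Once all coordinates in [J i] are chosen, the measure of cylinder [i] is 0 or 1, hence
    0. *)
Lemma branch_avoiding_cylinders (R : realType) (M : nat -> nat) (D : set nat)
    (J : nat -> seq nat) (t : nat -> nat -> nat) :
  (forall j, (0 < M j)%N) -> (forall i, D i -> uniq (J i)) ->
  (\esum_(i in D) (\prod_(j <- J i) ((M j)%:R^-1 : R))%:E < 1)%E ->
  exists2 sg : nat -> nat, forall j, (sg j < M j)%N &
    forall i, D i -> exists2 j, j \in J i & sg j <> t i j.
Proof.
move=> M0 uJ lt1.
(* [w p i] is the conditional measure of the cylinder [i] given the word [p];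
   averaging over the next letter keeps the total conditional measure < 1. *)
pose w (p : seq nat) i : R := \prod_(j <- J i)
  (if (j < size p)%N then (nth 0%N p j == t i j)%:R else (M j)%:R^-1).
have w0 p i : 0 <= w p i.
  by apply: prodr_ge0 => j _; case: ifP => // _; rewrite ?invr_ge0 ler0n.
have w_avg p i : D i ->
    \sum_(c < M (size p)) w (rcons p (nat_of_ord c)) i <=
    \sum_(c < M (size p)) w p i.
  move=> Di; rewrite sumr_const card_ord.
  have wE c j : j != size p ->
      (if (j < size (rcons p c))%N then (nth 0%N (rcons p c) j == t i j)%:R
       else (M j)%:R^-1 : R) =
      (if (j < size p)%N then (nth 0%N p j == t i j)%:R else (M j)%:R^-1).
    move=> jp; rewrite size_rcons ltnS leq_eqVlt (negbTE jp)/=.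
    by case: ifP => // jlt; rewrite nth_rcons jlt.
  have [pJ|pJ] := boolP (size p \in J i); last first.
    rewrite le_eqVlt; apply/orP; left; apply/eqP.
    rewrite -[X in _ *+ X](card_ord (M (size p))) -sumr_const.
    apply: eq_bigr => c _; rewrite /w; apply: eq_big_seq => j jJ.
    by apply: wE; apply: contraNneq pJ => <-.
  have wD q : w q i = (if (size p < size q)%N
        then (nth 0%N q (size p) == t i (size p))%:R else (M (size p))%:R^-1)
      * \prod_(j <- J i | j != size p)
      (if (j < size q)%N then (nth 0%N q j == t i j)%:R else (M j)%:R^-1).
    by rewrite /w (bigD1_seq (size p))//=; exact: uJ.
  pose v := \prod_(j <- J i | j != size p)
      (if (j < size p)%N then (nth 0%N p j == t i j)%:R else (M j)%:R^-1 : R).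
  have v0 : 0 <= v.
    by apply: prodr_ge0 => j _; case: ifP => // _; rewrite ?invr_ge0 ler0n.
  have -> : w p i *+ M (size p) = v.
    rewrite wD ltnn -/v -[LHS]mulr_natl mulrA mulfV ?mul1r//.
    by rewrite pnatr_eq0 -lt0n.
  have wr c : w (rcons p c) i = (c == t i (size p))%:R * v.
    rewrite wD size_rcons ltnSn nth_rcons ltnn eqxx; congr (_ * _).
    by apply: eq_bigr => j jp; rewrite -(size_rcons p c) wE.
  under eq_bigr do rewrite wr.
  rewrite -mulr_suml -[leRHS]mul1r ler_wpM2r// -natr_sum (_ : 1 = 1%:R)//.
  rewrite ler_nat.
  have [lt_t|ge_t] := ltnP (t i (size p)) (M (size p)).
    rewrite (bigD1 (Ordinal lt_t))//= eqxx big1 ?addn0// => c ct.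
    apply/eqP; rewrite eqb0; apply: contra ct => /eqP ct.
    exact/eqP/val_inj.
  rewrite big1// => c _; apply/eqP; rewrite eqb0.
  by apply: contraTneq (ltn_ord c) => ->; rewrite -leqNgt.
pose good p := (\esum_(i in D) (w p i)%:E < 1)%E.
(* If every letter brought the total to at least 1, summing over the [M (size p)] letters would
   contradict [w_avg]. *)
have step p : good p -> exists c, (c < M (size p))%N /\ good (rcons p c).
  move=> gp; apply: contrapT => /forallNP nc.
  have : (\sum_(c < M (size p))
            \esum_(i in D) (w (rcons p (nat_of_ord c)) i)%:E <=
          \sum_(c < M (size p)) \esum_(i in D) (w p i)%:E)%E.
    rewrite -!esum_sum; try by move=> *; rewrite lee_fin.
    by apply: le_esum => i Di; rewrite !sumEFin lee_fin w_avg.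
  apply/negP; rewrite -ltNge.
  apply: (@lt_le_trans _ _ (\sum_(c < M (size p)) 1)%E).
    have S0 : (0 <= \esum_(i in D) (w p i)%:E)%E.
      by apply: esum_ge0 => i _; rewrite lee_fin.
    move: gp S0; rewrite /good; case: (\esum_(i in D) _)%E => [r| |]//.
    rewrite lte_fin => r1 _.
    rewrite !sumEFin lte_fin !sumr_const !card_ord.
    by rewrite ltr_pMn2r.
  apply: lee_sum => c _; rewrite leNgt; apply/negP => gc.
  by apply: (nc c); split.
have [ch chP] : exists ch : seq nat -> nat, forall p, good p ->
    (ch p < M (size p))%N /\ good (rcons p (ch p)).
  have /choice[ch chP] : forall p, exists c, good p ->
      (c < M (size p))%N /\ good (rcons p c).
    move=> p; have [/step[c]|] := pselect (good p); first by exists c.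
    by exists 0%N.
  by exists ch.
pose P n := iter n (fun p => rcons p (ch p)) [::].
have sP n : size (P n) = n by elim: n => //= n IH; rewrite size_rcons IH.
have gP n : good (P n).
  elim: n => [|n IH /=]; last by have [] := chP _ IH.
  rewrite /good/=; under eq_esum => i _.
    rewrite (_ : w [::] i = \prod_(j <- J i) (M j)%:R^-1); last by [].
    over.
  exact: lt1.
have nP n j : (j < n)%N -> nth 0%N (P n) j = ch (P j).
  elim: n => // n IH; rewrite ltnS leq_eqVlt => /orP[/eqP ->|jn] /=.
    by rewrite nth_rcons sP ltnn eqxx.
  by rewrite nth_rcons sP jn IH.
exists (fun j => ch (P j)).
  by move=> j; have [+ _] := chP _ (gP j); rewrite sP.
move=> i Di; apply: contrapT => noj.
have eqj j : j \in J i -> ch (P j) = t i j.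
  by move=> jJ; apply: contrapT => ne; apply: noj; exists j.
(* A word of this length fixes all coordinates in [J i], so a branch inside cylinder [i] gives it
   conditional measure 1. *)
pose n := (\max_(j <- J i) j).+1.
have : (1 <= \esum_(i in D) (w (P n) i)%:E)%E.
  apply: esum_ge; exists [set i]; first by split=> // ? ->.
  rewrite fsbig_set1 /w big1_seq// => j /andP[_ jJ].
  have jn : (j < n)%N by rewrite ltnS; apply: leq_bigmax_seq.
  by rewrite sP jn nP// eqj// eqxx.
by apply/negP; rewrite -ltNge; exact: gP.
Qed.

(* If each set of a countable cover meets the points [x sg] only inside one
   cylinder, the cover induces a cover by cylinders, of total measure >= 1. *)
Lemma mass_distribution (R : realType) (T : Type) (M : nat -> nat)
    (x : (nat -> nat) -> T) (D : set nat) (U : nat -> set T)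
    (rho : nat -> \bar R) (C : R) :
  (forall j, (0 < M j)%N) -> 0 < C ->
  (forall i, 0 <= rho i)%E ->
  (forall sg, (forall j, (sg j < M j)%N) -> exists2 i, D i & U i (x sg)) ->
  (forall i (eta : R), D i -> 0 < eta -> exists J : seq nat,
    [/\ uniq J,
        forall sg sg' : nat -> nat, (forall j, (sg j < M j)%N) ->
          (forall j, (sg' j < M j)%N) -> U i (x sg) -> U i (x sg') ->
          forall j, j \in J -> sg j = sg' j &
        ((\prod_(j <- J) ((M j)%:R^-1 : R))%:E <= C%:E * rho i + eta%:E)%E]) ->
  (((2 * C)^-1)%:E <= \esum_(i in D) rho i)%E.
Proof.
move=> M0 C0 rho0 cov loc.
rewrite leNgt; apply/negP => small.
(* These errors sum to 1/2, and [small] leaves less than 1/2 for [C] times the sum of [rho]. *)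
pose eta i : R := (2^-1) / (2 ^ i.+1)%:R.
have eta0 i : 0 < eta i by rewrite divr_gt0// ltr0n expn_gt0.
have /choice[J JP] : forall i, exists J : seq nat, D i -> [/\ uniq J,
    forall sg sg' : nat -> nat, (forall j, (sg j < M j)%N) ->
      (forall j, (sg' j < M j)%N) -> U i (x sg) -> U i (x sg') ->
      forall j, j \in J -> sg j = sg' j &
    ((\prod_(j <- J) ((M j)%:R^-1 : R))%:E <= C%:E * rho i + (eta i)%:E)%E].
  move=> i; have [Di|nD] := pselect (D i); last by exists [::].
  by have [J ?] := loc i _ Di (eta0 i); exists J.
(* Any branch whose point lies in [U i] names the one cylinder that [U i] can meet. *)
have /choice[t tP] : forall i, exists t : nat -> nat,
    (exists sg, (forall j, (sg j < M j)%N) /\ U i (x sg)) ->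
    (forall j, (t j < M j)%N) /\ U i (x t).
  move=> i; have [[sg ?]|] := pselect (exists sg,
    (forall j, (sg j < M j)%N) /\ U i (x sg)); first by exists sg.
  by exists (fun=> 0%N).
have [] := @branch_avoiding_cylinders R M D J t M0.
- by move=> i /JP[].
- apply: (@le_lt_trans _ _ (\esum_(i in D) (C%:E * rho i + (eta i)%:E))%E).
    by apply: le_esum => i /JP[].
  have -> : D = [set i | i \in D] by apply/seteqP; split => i /=; rewrite inE.
  rewrite -nneseries_esum; last first.
    by move=> i _; rewrite adde_ge0 ?mule_ge0 ?lee_fin// ltW.
  apply: (@le_lt_trans _ _
    (\sum_(i <oo | i \in D) (C%:E * rho i) + (2^-1)%:E)%E).
    apply: epsilon_trick => [n|]; last by rewrite invr_ge0.
    by rewrite mule_ge0// lee_fin ltW.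
  rewrite nneseriesZl//.
  rewrite nneseries_esum// (_ : [set i | i \in D] = D); last first.
    by apply/seteqP; split => i /=; rewrite inE.
  have : (0 <= \esum_(i in D) rho i)%E by exact: esum_ge0.
  move: small; case: (\esum_(i in D) rho i)%E => [r| |]//.
  rewrite lte_fin => rC _; rewrite -EFinM -EFinD lte_fin.
  move: rC; rewrite invfM ltr_pdivlMr// => rC.
  by rewrite [ltRHS](splitr 1) div1r ltrD2r mulrC.
move=> sg sgM av; have [i Di Ui] := cov _ sgM.
have [j jJ] := av _ Di.
have [tM tU] := tP i (ex_intro _ sg (conj sgM Ui)).
by have [_ /(_ sg (t i) sgM tM Ui tU j jJ)] := JP _ Di.
Qed.

(** * Entropy and dimension from covers *)

Lemma lim_at_right0_nonincreasing (R : realType) (u : R -> \bar R) :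
  {in `]0, +oo[ &, nonincreasing_fun u} ->
  lim (u x @[x --> (0 : R)^'+]) = ereal_sup (u @` `]0, +oo[).
Proof.
by move=> ?; apply/cvg_lim => //; exact: nonincreasing_at_right_cvge.
Qed.

Lemma bowen_outer_ge0 (R : realType) (X : metricType R) (f : X -> X)
    (s : R) (M : nat) (eps : R) (Z : set X) :
  (0 <= bowen_outer f s M eps Z)%E.
Proof.
apply: le_ereal_inf_tmp => _ [D [x [n [_ _ ->]]]].
by apply: esum_ge0 => i _; rewrite lee_fin expR_ge0.
Qed.

Lemma bowen_outer_le_measure (R : realType) (X : metricType R) (f : X -> X)
    (s : R) (M : nat) (eps : R) (Z : set X) :
  (bowen_outer f s M eps Z <= bowen_measure f s eps Z)%E.
Proof.
have nd : nondecreasing_seq (fun M => bowen_outer f s M eps Z).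
  move=> m n mn; apply: le_ereal_inf => _ [D [x [k [kn ? ->]]]].
  by exists D, x, k; split => // i /kn; exact: leq_trans.
rewrite /bowen_measure (cvg_lim _ (ereal_nondecreasing_cvgn nd))//.
by apply: ereal_sup_ubound; exists M.
Qed.

Lemma bowen_measure_eq0 (R : realType) (X : metricType R) (f : X -> X)
    (s : R) (eps : R) (Z : set X) :
  bowen_measure f s eps Z = 0%E <-> forall M, bowen_outer f s M eps Z = 0%E.
Proof.
split=> [m0 M|m0].
  by apply/eqP; rewrite eq_le bowen_outer_ge0 -m0 bowen_outer_le_measure.
rewrite /bowen_measure (_ : (fun _ => _) = cst 0%E) ?lim_cst//.
exact/funext.
Qed.

Lemma htop_scale_nonincreasing (R : realType) (X : metricType R) (f : X -> X)
    (Z : set X) : nonincreasing_fun (htop_scale f Z).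
Proof.
move=> e e' ee'; apply: le_ereal_inf => _ [s [s0 /bowen_measure_eq0 ms] <-].
exists s => //; split => //; apply/bowen_measure_eq0 => M.
apply/eqP; rewrite eq_le bowen_outer_ge0 andbT -(ms M).
apply: le_ereal_inf => _ [D [x [n [nM ZD ->]]]]; exists D, x, n; split => //.
move=> y /ZD[i Di yi]; exists i => // k kn.
exact: lt_le_trans (yi _ kn) ee'.
Qed.

Lemma htopE (R : realType) (X : metricType R) (f : X -> X) (Z : set X) :
  htop f Z = ereal_sup (htop_scale f Z @` `]0, +oo[).
Proof.
apply: lim_at_right0_nonincreasing => e e' _ _.
exact: htop_scale_nonincreasing.
Qed.

Lemma htop_scale_ge0 (R : realType) (X : metricType R) (f : X -> X)
    (Z : set X) (eps : R) : (0 <= htop_scale f Z eps)%E.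
Proof. by apply: le_ereal_inf_tmp => _ [s [s0 _] <-]; rewrite lee_fin. Qed.

Lemma htop_scale_le_htop (R : realType) (X : metricType R) (f : X -> X)
    (Z : set X) (eps : R) : 0 < eps -> (htop_scale f Z eps <= htop f Z)%E.
Proof.
move=> e0; rewrite htopE; apply: ereal_sup_ubound.
by exists eps => //=; rewrite in_itv/= e0.
Qed.

Lemma htop_ge0 (R : realType) (X : metricType R) (f : X -> X) (Z : set X) :
  (0 <= htop f Z)%E.
Proof.
exact: le_trans (htop_scale_ge0 f Z 1) (htop_scale_le_htop f Z ltr01).
Qed.

(** Below [s] the sums only grow, so they stay at least [c] and no [s' < s] has measure 0. One scale
    is enough, as [htop] is a supremum over scales. *)
Lemma htop_ge (R : realType) (X : metricType R) (f : X -> X) (Z : set X)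
    (s eps c : R) : 0 < eps -> 0 < c ->
  (forall (D : set nat) (x : nat -> X) (n : nat -> nat),
     Z `<=` \bigcup_(i in D) bowen_ball (n i) (x i) eps f ->
     (c%:E <= \esum_(i in D) (expR (- s * (n i)%:R))%:E)%E) ->
  (s%:E <= htop f Z)%E.
Proof.
move=> e0 c0 cP; apply: le_trans (htop_scale_le_htop f Z e0).
apply: le_ereal_inf_tmp => _ [s' [s'0 /bowen_measure_eq0 ms] <-].
rewrite lee_fin leNgt; apply/negP => ss'.
have : (c%:E <= bowen_outer f s' 0 eps Z)%E.
  apply: le_ereal_inf_tmp => _ [D [x [n [_ ZD ->]]]].
  apply: le_trans (cP _ _ _ ZD) _; apply: le_esum => i _.
  by rewrite lee_fin ler_expR !mulNr lerN2 ler_wpM2r// ltW.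
by rewrite ms lee_fin leNgt c0.
Qed.

(** Turns large entropy into a positive lower bound for cover sums, from which separated points are
    found by counting. *)
Lemma htop_gt_bowen_outer (R : realType) (X : metricType R) (f : X -> X)
    (Z : set X) (h : R) : 0 <= h -> (h%:E < htop f Z)%E ->
  exists eps M (m : R), [/\ 0 < eps, 0 < m &
    (m%:E <= bowen_outer f h M eps Z)%E].
Proof.
move=> h0; rewrite htopE => /ereal_sup_gt[_ [eps /= + <-] hlt].
rewrite in_itv/= andbT => e0.
have [M mM] : exists M, bowen_outer f h M eps Z <> 0%E.
  apply/existsNP => /bowen_measure_eq0 m0; move: hlt; apply/negP.
  by rewrite -leNgt; apply: ereal_inf_lbound; exists h.
have : (0 < bowen_outer f h M eps Z)%E.
  by rewrite lt_def bowen_outer_ge0 andbT; exact/eqP.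
move=> b0; exists eps, M; case: (bowen_outer f h M eps Z) b0 => [r| |]// r0.
  by exists r; split => //; rewrite -lte_fin.
by exists 1; rewrite leey.
Qed.

(** * Hausdorff dimension from covers *)

Lemma diam_ge0 (R : realType) (X : metricType R) (U : set X) :
  (0 <= diam U)%E.
Proof. by apply: ereal_sup_ubound; left. Qed.

Lemma mdist_le_diam (R : realType) (X : metricType R) (U : set X) (x y : X) :
  U x -> U y -> ((mdist x y)%:E <= diam U)%E.
Proof. by move=> Ux Uy; apply: ereal_sup_ubound; right; exists (x, y). Qed.

Lemma hausdorff_dim_ge0 (R : realType) (X : metricType R) (A : set X) :
  (0 <= hausdorff_dim A)%E.
Proof. by apply: le_ereal_inf_tmp => _ [s [s0 _] <-]; rewrite lee_fin. Qed.

(** Diameters are at most 1, so lowering the exponent from [s] to [s'] only increases the sums. *)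
Lemma hausdorff_dim_ge (R : realType) (X : metricType R) (A : set X)
    (s delta c : R) : 0 < delta -> delta <= 1 -> 0 < c ->
  (forall (D : set nat) (U : nat -> set X),
     (forall i, D i -> (diam (U i) <= delta%:E)%E) ->
     A `<=` \bigcup_(i in D) U i ->
     (c%:E <= \esum_(i in D) (diam (U i) `^ s))%E) ->
  (s%:E <= hausdorff_dim A)%E.
Proof.
move=> d0 d1 c0 cP.
apply: le_ereal_inf_tmp => _ [s' [s'0 ms'] <-].
rewrite lee_fin leNgt; apply/negP => ss'.
have : (c%:E <= hausdorff_measure s' A)%E.
  rewrite /hausdorff_measure lim_at_right0_nonincreasing; last first.
    move=> e e' _ _ ee'; apply: le_ereal_inf => _ [D [U [UD AD ->]]].
    exists D, U; split => // i /UD /le_trans; apply; by rewrite lee_fin.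
  apply: (@le_trans _ _ (hausdorff_outer s' delta A)); last first.
    by apply: ereal_sup_ubound; exists delta => //=; rewrite in_itv/= d0.
  apply: le_ereal_inf_tmp => _ [D [U [UD AD ->]]].
  apply: le_trans (cP _ _ UD AD) _; apply: le_esum => i Di.
  have := UD _ Di; have := diam_ge0 (U i).
  case: (diam (U i)) => [r| |]//; rewrite !lee_fin => r0 rd.
  rewrite /=.
  have [->|rn0] := eqVneq r 0; first by
    rewrite powR0 ?gt_eqF ?powR_ge0// (le_lt_trans s'0).
  have rp : 0 < r by rewrite lt_def rn0.
  by apply: ger_powR; rewrite ?rp ?(le_trans rd)// ltW.
by rewrite ms' lee_fin leNgt c0.
Qed.

(** * Separated points *)

Lemma lipschitz_withP (R : realType) (X : metricType R) (L : R) (f : X -> X) :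
  lipschitz_with L f -> forall x y, mdist (f x) (f y) <= L * mdist x y.
Proof.
move=> Lf x y; have [->|xy] := eqVneq x y; first by rewrite !mdistxx mulr0.
rewrite -ler_pdivrMr ?mdist_gt0// -lee_fin; apply: le_trans Lf.
by apply: ereal_sup_ubound; exists (x, y) => //=; exact/eqP.
Qed.

Lemma lipschitz_ge1 (R : realType) (X : metricType R) (f : X -> X) :
  (exists L : R, lipschitz_with L f) ->
  exists2 L : R, 1 <= L & forall x y, mdist (f x) (f y) <= L * mdist x y.
Proof.
move=> [L /lipschitz_withP Lf]; exists (Num.max 1 L).
  by rewrite le_max lexx.
move=> x y; apply: le_trans (Lf x y) _.
by rewrite ler_wpM2r ?mdist_ge0// le_max lexx orbT.
Qed.

Lemma mdist_iter_le (R : realType) (X : metricType R) (L : R) (f : X -> X)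
    n x y : 0 <= L -> (forall x y, mdist (f x) (f y) <= L * mdist x y) ->
  mdist (iter n f x) (iter n f y) <= L ^+ n * mdist x y.
Proof.
move=> L0 Lf; elim: n => [|n IH]; first by rewrite expr0 mul1r.
by rewrite exprS -mulrA; apply: le_trans (Lf _ _) _; rewrite ler_wpM2l.
Qed.

Lemma mdist_iter_le_max (R : realType) (X : metricType R) (L : R) (f : X -> X)
    n N x y : 1 <= L -> (forall x y, mdist (f x) (f y) <= L * mdist x y) ->
  (n <= N)%N -> mdist (iter n f x) (iter n f y) <= L ^+ N * mdist x y.
Proof.
move=> L1 Lf nN; apply: le_trans (mdist_iter_le n x y _ Lf) _.
  exact: le_trans L1.
by rewrite ler_wpM2r ?mdist_ge0// ler_weXn2l.
Qed.

(** A cover by [k] balls of the common length [n] would have too small a sum. This drives the greedy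
    choice of separated points. *)
Lemma uncovered_point (R : realType) (X : metricType R) (f : X -> X)
    (h eps m : R) (M n k : nat) (x : nat -> X) :
  (m%:E <= bowen_outer f h M eps setT)%E -> (M <= n)%N ->
  k%:R * expR (- h * n%:R) < m ->
  exists y, forall i, (i < k)%N -> ~ bowen_ball n (x i) eps f y.
Proof.
move=> mle Mn klt; apply: contrapT => /forallNP cov.
have : (m%:E <= (k%:R * expR (- h * n%:R))%:E)%E.
  apply: le_trans mle _; apply: ereal_inf_lbound.
  exists `I_k, x, (fun=> n); split => //.
    move=> y _; have /existsNP[i /not_implyP[ik /contrapT yi]] := cov y.
    by exists i.
  rewrite esum_fset//.
  by rewrite -fsbig_ord sumEFin sumr_const card_ord mulr_natl.
by rewrite lee_fin leNgt klt.
Qed.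

(** Greedy choice: a point outside the Bowen balls around the [N] images [f^l (y c)] of each earlier
    point is itself some [f^l w] with [w] in [Y]. Comparing it with [f^l (y c)] for the same [l]
    separates [w] from [y c]. *)
Lemma separated_points_pos (R : realType) (X : metricType R) (f : X -> X)
    (Y : set X) (N : nat) (L h : R) :
  (0 < N)%N -> 1 <= L ->
  (forall x y, mdist (f x) (f y) <= L * mdist x y) ->
  [set: X] = \bigcup_(l < N) (iter l f @` Y) -> Y !=set0 ->
  0 <= h -> (h%:E < htop f [set: X])%E ->
  exists (eps : R) (M0 : nat), 0 < eps /\ forall m, (M0 <= m)%N ->
    exists (K : nat) (y : nat -> X),
      [/\ expR (h * (N * m)%:R) <= K%:R, forall c, (c < K)%N -> Y (y c) &
        forall c c', (c < K)%N -> (c' < K)%N -> c <> c' ->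
          exists2 i, (i < m)%N & eps <= mdist (iter i (iter N f) (y c))
                                           (iter i (iter N f) (y c'))].
Proof.
move=> N0 L1 Lf XY [y0 _] h0 hlt.
have L0 : 0 < L by exact: lt_le_trans L1.
(* The slack [h < h1] absorbs the factor [N] and the last [N] steps. *)
have [h1 hh1 h1lt] : exists2 h1, h < h1 & (h1%:E < htop f setT)%E.
  move: hlt; case: (htop f setT) => [r| |]//.
    rewrite lte_fin => hr; exists ((h + r) / 2); first lra.
    by rewrite lte_fin; lra.
  by move=> _; exists (h + 1); rewrite ?ltry//; lra.
have h10 : 0 <= h1 by rewrite ltW// (le_lt_trans h0).
have [eps [M [m0 [eps0 m00 m0le]]]] := htop_gt_bowen_outer h10 h1lt.
have LN0 : 0 < L ^+ N by rewrite exprn_gt0.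
have core n : (M <= n)%N -> forall K,
    (0 < K)%N -> (N * K.-1)%:R * expR (- h1 * n%:R) < m0 ->
    exists y : nat -> X, (forall c, (c < K)%N -> Y (y c)) /\
      forall c c', (c' < c)%N -> (c < K)%N -> exists2 i, (i < n + N)%N &
        eps <= mdist (iter i f (y c')) (iter i f (y c)).
  move=> Mn; elim => // K IH _ /= Klt.
  have [y [Yy sepy]] : exists y : nat -> X, (forall c, (c < K)%N -> Y (y c)) /\
      forall c c', (c' < c)%N -> (c < K)%N -> exists2 i, (i < n + N)%N &
        eps <= mdist (iter i f (y c')) (iter i f (y c)).
    have [->|K0] := posnP K.
      by exists (fun=> y0).
    apply: IH => //; apply: le_lt_trans Klt.
    by rewrite ler_wpM2r ?expR_ge0// ler_nat leq_mul2l leq_pred orbT.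
  (* The index [i] encodes a pair: earlier point [i / N], iterate [i mod N]. *)
  have [x xP] := uncovered_point
    (fun i => iter (i %% N)%N f (y (i %/ N)%N)) m0le Mn Klt.
  have : [set: X] x by [].
  rewrite XY => -[l /= lN [w Yw wx]].
  exists (fun c => if (c < K)%N then y c else w); split.
    by move=> c; rewrite ltnS; case: ifP => // /Yy.
  move=> c c' c'c; rewrite ltnS leq_eqVlt => /orP[/eqP cK|cK]; last first.
    by rewrite cK (ltn_trans c'c cK); exact: sepy.
  rewrite cK ltnn -cK c'c.
  have lt1 : (c' * N + l < N * K)%N.
    rewrite -cK (mulnC N) (leq_trans _ (leq_mul c'c (leqnn N)))//.
    by rewrite mulSn addnC ltn_add2r.
  have := xP _ lt1; rewrite divnMDl// modnMDl divn_small// modn_small// addn0.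
  move=> /existsNP[i /not_implyP[ilt /negP]]; rewrite -leNgt -wx -!iterD.
  by exists (i + l)%N => //; rewrite -addSn leq_add// ltnW.
have lim : exists M1, forall m, (M1 <= m)%N ->
    N%:R * expR (h * (N * m)%:R) * expR (- h1 * (N * m.-1)%:R) < m0.
  pose a := (h1 - h) * N%:R.
  have a0 : 0 < a by rewrite mulr_gt0 ?ltr0n//; lra.
  pose b := ln (m0 / N%:R) - h1 * N%:R.
  exists (Num.truncn (`|b| / a)).+2 => m mlt.
  have m1 : (0 < m)%N by case: m mlt.
  rewrite -mulrA mulrC -ltr_pdivlMr ?ltr0n// -expRD.
  rewrite -[ltRHS]lnK ?posrE ?divr_gt0 ?ltr0n// ltr_expR.
  have : `|b| < a * m%:R.
    rewrite -ltr_pdivrMl// mulrC; apply: lt_le_trans (truncnS_gt _) _.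
    by rewrite ler_nat ltnW.
  have := ler_norm (- b); rewrite normrN => bb ba.
  have : - b < a * m%:R by exact: le_lt_trans ba.
  have -> : (N * m.-1)%:R = N%:R * m%:R - N%:R :> R.
    by rewrite -subn1 mulnBr muln1 natrB ?leq_pmulr// natrM.
  by rewrite /a /b natrM; clear; lra.
have [M1 M1P] := lim.
(* Time [i] of [f] is fewer than [N] steps after time [i / N] of [f^N], which costs at most a factor
   [L ^+ N] in distance. *)
exists (eps / L ^+ N), (maxn M1 (M + 2)); split; first by rewrite divr_gt0.
move=> m; rewrite geq_max => /andP[M1m Mm].
pose K := (Num.truncn (expR (h * (N * m)%:R))).+1.
have [|//||y [Yy sepy]] := core (N * m.-1)%N _ K.
- by apply: leq_trans (leq_pmull m.-1 N0); clear -Mm; lia.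
- apply: le_lt_trans (M1P _ M1m); rewrite ler_wpM2r ?expR_ge0//.
  by rewrite natrM ler_wpM2l// truncn_le expR_ge0.
have sep c c' : (c' < c)%N -> (c < K)%N -> exists2 i, (i < m)%N &
    eps / L ^+ N <= mdist (iter i (iter N f) (y c')) (iter i (iter N f) (y c)).
  move=> c'c cK; have [i ilt epsi] := sepy _ _ c'c cK.
  exists (i %/ N)%N.
    by rewrite ltn_divLR// (leq_trans ilt)//; clear -Mm N0; nia.
  rewrite ler_pdivrMr// mulrC; apply: le_trans epsi _.
  rewrite [X in iter X](divn_eq i N) addnC !iterD !iterM.
  by apply: mdist_iter_le_max => //; rewrite ltnW// ltn_mod.
exists K, y; split => //.
  by rewrite ltW// truncnS_gt.
move=> c c' cK c'K /eqP; rewrite neq_ltn => /orP[cc'|c'c]; last first.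
  by have [i im e] := sep _ _ c'c cK; exists i => //; rewrite metric_sym.
exact: sep.
Qed.

(** For [h = 0] one point suffices; this case keeps the construction available when the entropy is
    0. *)
Lemma separated_points (R : realType) (X : metricType R) (f : X -> X)
    (Y : set X) (N : nat) (L h : R) :
  (0 < N)%N -> 1 <= L ->
  (forall x y, mdist (f x) (f y) <= L * mdist x y) ->
  [set: X] = \bigcup_(l < N) (iter l f @` Y) -> Y !=set0 ->
  0 <= h -> h = 0 \/ (h%:E < htop f [set: X])%E ->
  exists (eps : R) (M0 : nat), 0 < eps /\ forall m, (M0 <= m)%N ->
    exists (K : nat) (y : nat -> X),
      [/\ expR (h * (N * m)%:R) <= K%:R, forall c, (c < K)%N -> Y (y c) &
        forall c c', (c < K)%N -> (c' < K)%N -> c <> c' ->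
          exists2 i, (i < m)%N & eps <= mdist (iter i (iter N f) (y c))
                                           (iter i (iter N f) (y c'))].
Proof.
move=> N0 L1 Lf XY Y0 h0 [->|]; last exact: (separated_points_pos N0 L1 Lf).
have [y0 Yy0] := Y0.
exists 1, 0%N; split => // m _; exists 1%N, (fun=> y0).
by rewrite mul0r expR0; split=> [|//|[|c] [|c']].
Qed.

(** * Shadowing of infinitely many blocks *)

(** The estimate is a closed condition. Only a tail is required, since a given block is shadowed by
    [v n] for large [n] only. *)
Lemma cluster_mdist_le (R : realType) (X : metricType R) (phi : X -> X)
    (v : nat -> X) (v0 a : X) (d : R) (n0 : nat) :
  {for v0, continuous phi} -> cluster (v @ \oo) v0 ->
  (forall n, (n0 <= n)%N -> mdist a (phi (v n)) <= d) ->
  mdist a (phi v0) <= d.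
Proof.
move=> phic clv vd; rewrite leNgt; apply/negP => dlt.
have e0 : 0 < mdist a (phi v0) - d by rewrite subr_gt0.
have near_v0 : nbhs v0 [set y | mdist (phi v0) (phi y) < mdist a (phi v0) - d].
  exact: (metricType_numDomainType.cvgr_dist_lt phic).
have tail : (v @ \oo) (v @` [set n | (n0 <= n)%N]).
  by exists n0 => // n /= n0n; exists n.
have [_ [[n /= n0n <-]]] := clv _ _ tail near_v0.
rewrite ltrBrDr => /le_lt_trans-/(_ _ _) lt.
have := metric_triangle a (phi (v n)) (phi v0).
rewrite (metric_sym (phi (v n))) => /le_trans-/(_ _ (lerD (vd _ n0n) (lexx _))).
by rewrite leNgt addrC lt.
Qed.

Lemma iter_continuous (T : topologicalType) (g : T -> T) n :
  continuous g -> continuous (iter n g).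
Proof.
move=> gc; elim: n => [|n IH] x; first exact: cvg_id.
exact: continuous_comp (IH x) (gc _).
Qed.

Lemma iter_cancel (T : Type) (g gi : T -> T) n :
  cancel g gi -> cancel (iter n g) (iter n gi).
Proof. by move=> gK; elim: n => // n IH x; rewrite iterSr/= gK IH. Qed.

(* The block [xb k] starts at time [- k.+1 * (l + q')]; [v] is a limit of points
   that shadow finitely many blocks on both sides of time 0. *)
Lemma two_sided_shadowing (R : realType) (X : metricType R) (Y : set X)
    (g : X -> X) (l1 l2 eps : R) (p : nat -> nat) :
  (forall (k : nat) (x : nat -> X) (n q : nat -> nat), (0 < k)%N ->
     (forall i, (i < k)%N -> [/\ Y (x i), (0 < n i)%N & (p (n i) <= q i)%N]) ->
     exists z : X, Y z /\ forall i, (i < k)%N ->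
       exp_bowen_ball Y (n i) (x i) eps l1 l2 g
         (iter (\sum_(j < i) (n j + q j))%N g z)) ->
  compact Y -> continuous g ->
  forall (x xb : nat -> X) (n q : nat -> nat) (l q' : nat),
  (forall i, [/\ Y (x i), (0 < n i)%N & (p (n i) <= q i)%N]) ->
  (forall i, Y (xb i)) -> (0 < l)%N -> (p l <= q')%N ->
  exists v, [/\ Y v,
    forall k i, (i < n k)%N ->
      mdist (iter i g (x k)) (iter (\sum_(j < k) (n j + q j) + i)%N g v) <=
      eps * expR (- Num.min (i%:R * l1) (((n k)%:R - 1 - i%:R) * l2)) &
    forall gi : X -> X, continuous gi -> cancel g gi ->
      forall k i, (i < l)%N ->
      mdist (iter i g (xb k)) (iter (k.+1 * (l + q') - i)%N gi v) <=
      eps * expR (- Num.min (i%:R * l1) ((l%:R - 1 - i%:R) * l2))].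
Proof.
move=> spec cY gc x xb n q l q' xP xbP l0 q'P.
pose T := (l + q')%N.
(* For each [m]: the first [m] past blocks in reverse order, then the future blocks. *)
pose xx m i := if (i < m)%N then xb (m - i.+1)%N else x (i - m)%N.
pose nn m i := if (i < m)%N then l else n (i - m)%N.
pose qq m i := if (i < m)%N then q' else q (i - m)%N.
have sumlt m i : (i <= m)%N -> (\sum_(j < i) (nn m j + qq m j) = i * T)%N.
  move=> im; rewrite -[in RHS](card_ord i) -sum_nat_const.
  by apply: eq_bigr => j _; rewrite /nn /qq (leq_trans (ltn_ord j) im).
have sumge m k : (\sum_(j < m + k) (nn m j + qq m j) =
    m * T + \sum_(j < k) (n j + q j))%N.
  rewrite big_split_ord/=; congr addn; first exact: sumlt.
  by apply: eq_bigr => j _; rewrite /nn /qq ltnNge leq_addr/= addKn.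
have /choice[z zP] : forall m, exists z : X, Y z /\
  forall i, (i < m + m.+1)%N ->
    exp_bowen_ball Y (nn m i) (xx m i) eps l1 l2 g
      (iter (\sum_(j < i) (nn m j + qq m j))%N g z).
  move=> m; apply: spec => [|i _]; first by rewrite addnS.
  by rewrite /xx /nn /qq; case: ifP.
(* Moves the origin of time to the end of the past blocks. *)
pose v m := iter (m * T) g (z m).
have vY m : Y (v m).
  have [_ /(_ m)] := zP m; rewrite sumlt// => -[]//.
  by rewrite -addSnnS leq_addr.
have FY : (v @ \oo) Y by exists 0%N => // m _; exact: vY.
have [v0 [Yv0 clv]] := cY (v @ \oo) _ FY.
exists v0; split => //.
- move=> k i ik; apply: (cluster_mdist_le (n0 := k) _ clv).
    exact: iter_continuous.
  move=> m km; have [_ /(_ (m + k)%N)] := zP m.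
  rewrite sumge /nn /xx [(m + k < m)%N]ltnNge leq_addr/= addKn.
  move=> -[|_ /(_ _ ik)/ltW].
    by rewrite ltn_add2l ltnS.
  set S := (\sum_(j < k) _)%N.
  by rewrite /v -!iterD (_ : S + i + m * T = i + (m * T + S))%N//; clear; lia.
move=> gi gic gK k i il; apply: (cluster_mdist_le (n0 := k.+1) _ clv).
  exact: iter_continuous.
move=> m km; have [_ /(_ (m - k.+1)%N)] := zP m.
have lt : (m - k.+1 < m)%N by clear -km; lia.
rewrite sumlt ?(ltnW lt)// /nn /xx lt (_ : m - (m - k.+1).+1 = k)%N; last first.
  by clear -km; lia.
case; first by rewrite (leq_trans lt)// leq_addr.
move=> _ /(_ _ il)/ltW.
(* [v m] lies on the forward orbit of [z m], so [gi] retraces that orbit exactly. *)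
have -> : v m = iter (k.+1 * T - i) g (iter (i + (m - k.+1) * T) g (z m)).
  rewrite -iterD; congr iter; rewrite addnA subnK; last first.
    by rewrite mulSn -addnA (leq_trans (ltnW il))// leq_addr.
  by rewrite -mulnDl subnKC.
by rewrite iter_cancel// -iterD.
Qed.

(** * The timeline of blocks and targets *)

Lemma limn_esup_lt (R : realType) (u : nat -> \bar R) (a : \bar R) :
  (limn_esup u < a)%E -> exists n0, forall n, (n0 <= n)%N -> (u n < a)%E.
Proof.
rewrite /limn_esup limf_esupE => /ereal_inf_lt[_ [V [n0 _ n0V] <-] supa].
exists n0 => n n0n; apply: le_lt_trans supa.
by apply: ereal_sup_ubound; exists n => //; exact: n0V.
Qed.

Lemma sublinear_gap (R : realType) (p : nat -> nat) :
  limn_esup (fun n => ((p n)%:R / n%:R : R)%:E) = 0%E ->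
  forall eta : R, 0 < eta -> exists n0, forall n, (n0 <= n)%N ->
    (p n)%:R <= eta * n%:R.
Proof.
move=> p0 eta eta0.
have [|n0 n0P] := @limn_esup_lt R (fun n => ((p n)%:R / n%:R : R)%:E) eta%:E.
  by rewrite p0 lte_fin.
exists n0.+1 => -[//|n] n0n.
have := n0P _ (ltnW n0n); rewrite lte_fin ltr_pdivrMr ?ltr0n// => /ltW.
exact.
Qed.

(** The margins [a], [b] and the sublinear gap are negligible against a long middle part [m]. *)
Lemma free_block_length (R : realType) (p : nat -> nat) (a b M0 : nat)
    (th : R) :
  (forall eta : R, 0 < eta -> exists n0, forall n, (n0 <= n)%N ->
    (p n)%:R <= eta * n%:R) ->
  0 < th -> th < 1 ->
  exists2 m, (M0 <= m)%N &
    th * (a + m + b + p (a + m + b)%N)%:R <= m%:R.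
Proof.
move=> psub th0 th1.
(* With this rate the gap costs half of the slack [1 - th]; [m] is then taken so large that the
   margins fit into the other half. *)
have [|n0 n0P] := psub ((1 - th) / (2 * th)).
  by rewrite divr_gt0// ?mulr_gt0//; lra.
have [m mP] : exists m, [/\ (M0 <= m)%N, (n0 <= m)%N &
    (1 + th) * (a + b)%:R <= (1 - th) * m%:R].
  exists (maxn (maxn M0 n0) (Num.truncn ((1 + th) * (a + b)%:R / (1 - th))).+1).
  split; [by rewrite !leq_max leqnn|by rewrite !leq_max leqnn orbT|].
  rewrite [leRHS]mulrC -ler_pdivrMr; last lra.
  apply: le_trans (ltW (truncnS_gt _)) _.
  by rewrite ler_nat leq_maxr.
exists m; first by case: mP.
have [_ n0m mab] := mP.
have abm : (a + m + b = m + (a + b))%N by clear; lia.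
have := n0P (a + m + b)%N; rewrite abm => /(_ (leq_trans n0m (leq_addr _ _))).
set P := p _; move: P => P; move: (a + b)%N mab => d mab; rewrite !natrD => Ple.
have : th * P%:R <= (1 - th) / 2 * (m%:R + d%:R).
  rewrite (_ : (1 - th) / 2 = th * ((1 - th) / (2 * th))); last first.
    by field; rewrite gt_eqF.
  by rewrite -mulrA ler_pM2l.
by move: mab; clear; lra.
Qed.

(* A target at time [q] costs [A] steps before [q] and [B + 1 + p n] after it,
   in which no letter is chosen: free choices at rate [th] up to that stretch
   give a mean rate at least [kap] beyond it. *)
Lemma target_window (R : realType) (p : nat -> nat) (N T : nat)
    (l1 l2 t kap th C : R) :
  (forall eta : R, 0 < eta -> exists n0, forall n, (n0 <= n)%N ->
    (p n)%:R <= eta * n%:R) ->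
  (0 < N)%N -> 0 < l1 -> 0 < l2 -> 0 <= t -> 0 <= kap -> 0 < th -> t < l1 ->
  kap * (1 + t / l2) < th * (1 - t / l1) -> 0 <= C ->
  forall e0, exists S0, forall s q, (S0 <= s)%N ->
    (s <= N * q + N)%N -> (N * q <= s + N)%N ->
  exists A B, [/\ C + t * s%:R <= A%:R * (N%:R * l1),
    C + t * s%:R <= B%:R * (N%:R * l2), (e0 + A <= q)%N &
    forall n, (A + B + 1 <= n <= A + T + B + 1)%N ->
      kap * (q + B + 1 + p n)%:R <= th * (q%:R - A%:R - T%:R - e0%:R)].
Proof.
move=> psub N0 l10 l20 t0 kap0 th0 tl1 gap C0 e0.
have NR : 1 <= N%:R :> R by rewrite ler1n.
have N0R : 0 < N%:R :> R by exact: lt_le_trans NR.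
pose al := t / l1; pose be := t / l2.
have al0 : 0 <= al by rewrite divr_ge0// ltW.
have be0 : 0 <= be by rewrite divr_ge0// ltW.
pose g := th * (1 - al) - kap * (1 + be).
have g0 : 0 < g by rewrite subr_gt0.
(* The gap [p n] then costs at most [g / 2] per unit of [s]; the constants must fit into the
   remaining [g / 2]. *)
pose eta := g / (2 * (kap * (al + be) + 1)).
have D0 : 0 < kap * (al + be) + 1 by rewrite ltr_wpDl// mulr_ge0// addr_ge0.
have eta0 : 0 < eta by rewrite divr_gt0// mulr_gt0.
have etaP : kap * eta * (al + be) <= g / 2.
  rewrite (_ : g / 2 = eta * (kap * (al + be) + 1)); last first.
    by rewrite /eta; field; rewrite gt_eqF.
  by move: eta0; clear; nra.
have [n0 n0P] := psub _ eta0.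
pose a1 := C / l1; pose b1 := C / l2.
have a10 : 0 <= a1 by rewrite divr_ge0// ltW.
have b10 : 0 <= b1 by rewrite divr_ge0// ltW.
pose c1 : R := a1 + N%:R * (n0%:R + 1).
pose c2 : R := b1 + N%:R.
have al1 : al < 1 by rewrite ltr_pdivrMr// mul1r.
(* Beyond [x] the [A] steps fit between [e0] and [q]; beyond [y] the terms independent of [s] are at
   most [g / 2 * s]. *)
pose x := (c1 + N%:R + N%:R * e0%:R) / (1 - al).
pose y :=
  (kap * (N%:R + c2 + N%:R + eta * (c1 + c2 + N%:R * (T%:R + 1))) +
   th * (N%:R + c1 + N%:R * (T%:R + e0%:R))) / (g / 2).
have [S0 [S01 S02]] : exists S0 : nat, x <= S0%:R /\ y <= S0%:R.
  exists (maxn (Num.truncn x).+1 (Num.truncn y).+1); split.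
    by apply: le_trans (ltW (truncnS_gt _)) _; rewrite ler_nat leq_maxl.
  by apply: le_trans (ltW (truncnS_gt _)) _; rewrite ler_nat leq_maxr.
exists S0 => s q Ss sNq Nqs.
pose xA := (C + t * s%:R) / (N%:R * l1).
pose xB := (C + t * s%:R) / (N%:R * l2).
have Cs0 : 0 <= C + t * s%:R by rewrite addr_ge0// mulr_ge0.
have xA0 : 0 <= xA by rewrite divr_ge0// mulr_ge0// ltW.
have xB0 : 0 <= xB by rewrite divr_ge0// mulr_ge0// ltW.
(* Adding [n0] makes every [n] of the window large enough for [n0P]. *)
pose A := ((Num.truncn xA).+1 + n0)%N; pose B := (Num.truncn xB).+1.
have A_ge : xA <= A%:R.
  by apply: le_trans (ltW (truncnS_gt _)) _; rewrite ler_nat leq_addr.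
have B_ge : xB <= B%:R by exact: ltW (truncnS_gt _).
have NA_le : N%:R * A%:R <= al * s%:R + c1.
  have /(ler_wpM2l (ltW N0R))/le_trans : A%:R <= xA + 1 + n0%:R :> R.
    by rewrite natrD -natr1 lerD2r// lerD2r// truncn_le.
  apply.
  rewrite (_ : N%:R * (xA + 1 + n0%:R) = al * s%:R + c1)//.
  by rewrite /xA /al /c1 /a1; field; rewrite !gt_eqF.
have NB_le : N%:R * B%:R <= be * s%:R + c2.
  have /(ler_wpM2l (ltW N0R))/le_trans : B%:R <= xB + 1 :> R.
    by rewrite -natr1 lerD2r// truncn_le.
  apply.
  rewrite (_ : N%:R * (xB + 1) = be * s%:R + c2)//.
  by rewrite /xB /be /c2 /b1; field; rewrite !gt_eqF.
have sR : S0%:R <= s%:R :> R by rewrite ler_nat.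
have sNqR : s%:R <= N%:R * q%:R + N%:R :> R by rewrite -natrM -natrD ler_nat.
have NqsR : N%:R * q%:R <= s%:R + N%:R :> R by rewrite -natrM -natrD ler_nat.
exists A, B; split.
- by move: A_ge; rewrite ler_pdivrMr ?mulr_gt0.
- by move: B_ge; rewrite ler_pdivrMr ?mulr_gt0.
- rewrite -(ler_nat R) natrD -(ler_pM2l N0R) mulrDr.
  have : c1 + N%:R + N%:R * e0%:R <= (1 - al) * s%:R.
    rewrite [leRHS]mulrC -ler_pdivrMr ?subr_gt0//.
    exact: le_trans S01 sR.
  by move: NA_le sNqR; clear; lra.
move=> n /andP[An nA].
have pn : (p n)%:R <= eta * (A%:R + T%:R + B%:R + 1).
  apply: le_trans (n0P n _) _; last first.
    by rewrite ler_pM2l// -!natrD natr1 ler_nat -addn1.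
  by apply: leq_trans An; rewrite /A -!addnA addnCA leq_addr.
rewrite -(ler_pM2l N0R).
have S2 : kap * (N%:R + c2 + N%:R + eta * (c1 + c2 + N%:R * (T%:R + 1))) +
     th * (N%:R + c1 + N%:R * (T%:R + e0%:R)) <= g / 2 * s%:R.
  rewrite [leRHS]mulrC -ler_pdivrMr ?divr_gt0//.
  exact: le_trans S02 sR.
have Npn : N%:R * (p n)%:R <=
    eta * ((al + be) * s%:R + (c1 + c2 + N%:R * (T%:R + 1))).
  apply: le_trans (_ : N%:R * (eta * (A%:R + T%:R + B%:R + 1)) <= _).
    by rewrite ler_pM2l.
  rewrite mulrCA ler_pM2l//; move: NA_le NB_le; clear; lra.
have lhs : N%:R * (q + B + 1 + p n)%:R <= s%:R + N%:R + (be * s%:R + c2) + N%:R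
    + eta * ((al + be) * s%:R + (c1 + c2 + N%:R * (T%:R + 1))).
  by rewrite !natrD; move: NqsR NB_le Npn; clear; lra.
have rhs : s%:R - N%:R - (al * s%:R + c1) - N%:R * (T%:R + e0%:R) <=
    N%:R * (q%:R - A%:R - T%:R - e0%:R).
  by move: sNqR NA_le; clear; lra.
rewrite mulrCA [leRHS]mulrCA.
apply: le_trans (ler_wpM2l kap0 lhs) _.
apply: le_trans (ler_wpM2l (ltW th0) rhs).
have : kap * eta * (al + be) * s%:R <= g / 2 * s%:R by rewrite ler_wpM2r.
by move: S2; rewrite /g; clear; lra.
Qed.

(* Block [k] starts at time [e k]. As long as a free block of length [T] ends
   [A] before the next target time [Q], insert one, which multiplies the number
   of words by [K]; otherwise jump past the target. *)
Lemma timeline (R : realType) (T K : nat) (p : nat -> nat)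
    (Q A B : nat -> nat -> nat) (kap h : R) :
  (0 < T)%N -> 0 <= kap -> kap <= h -> expR (h * T%:R) <= K%:R ->
  (forall t e0, (e0 + A t e0 <= Q t e0)%N /\
    forall n, (A t e0 + B t e0 + 1 <= n <= A t e0 + T + B t e0 + 1)%N ->
      kap * (Q t e0 + B t e0 + 1 + p n)%:R <=
      h * ((Q t e0)%:R - (A t e0)%:R - T%:R - e0%:R)) ->
  exists (e t e0 : nat -> nat) (free : nat -> bool),
  [/\ e 0%N = 0%N,
      forall k, if free k then e k.+1 = (e k + T)%N else
        (e k + A (t k) (e0 k) <= Q (t k) (e0 k))%N /\
        e k.+1 = (Q (t k) (e0 k) + B (t k) (e0 k) + 1 +
          p (Q (t k) (e0 k) - e k + B (t k) (e0 k) + 1))%N,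
      forall k, expR (kap * (e k.+1)%:R - kap * T%:R) <=
        \prod_(j < k) (if free j then K else 1)%:R &
      forall t0, exists k, ~~ free k /\ t k = t0].
Proof.
move=> T0 kap0 kaph Kge QP.
have h0 : 0 <= h by exact: le_trans kaph.
(* A state consists of the current time, the stage, and the time at which the stage began. *)
pose isfree (s : nat * nat * nat) :=
  (s.1.1 + T + A s.1.2 s.2 <= Q s.1.2 s.2)%N.
pose jump (s : nat * nat * nat) := (Q s.1.2 s.2 + B s.1.2 s.2 + 1 +
  p (Q s.1.2 s.2 - s.1.1 + B s.1.2 s.2 + 1))%N.
pose step (s : nat * nat * nat) := if isfree s then (s.1.1 + T, s.1.2, s.2)%N
  else (jump s, s.1.2.+1, jump s).
pose s k := iter k step (0, 0, 0)%N.
pose W k : R := \prod_(j < k) (if isfree (s j) then K else 1)%:R.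
(* Within a stage the number of words grows at the full rate [h]; overall it keeps the mean rate
   [kap], also across jumps. The last bound looks one block ahead, which costs at most [T]. *)
have inv k : [/\ ((s k).2 <= (s k).1.1)%N,
    ((s k).1.1 + A (s k).1.2 (s k).2 <= Q (s k).1.2 (s k).2)%N,
    expR (h * ((s k).1.1%:R - (s k).2%:R)) <= W k,
    expR (kap * (s k).1.1%:R) <= W k &
    expR (kap * (s k.+1).1.1%:R - kap * T%:R) <= W k].
  have last_bound j : ((s j).2 <= (s j).1.1)%N ->
      ((s j).1.1 + A (s j).1.2 (s j).2 <= Q (s j).1.2 (s j).2)%N ->
      expR (h * ((s j).1.1%:R - (s j).2%:R)) <= W j ->
      expR (kap * (s j).1.1%:R) <= W j ->
      expR (kap * (s j.+1).1.1%:R - kap * T%:R) <= W j /\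
      (~~ isfree (s j) -> expR (kap * (jump (s j))%:R) <= W j).
    have sS : s j.+1 = step (s j) by [].
    rewrite sS; case: (s j) => [[e t] e0] /= e0e eA Wh Wk.
    have jumpP : ~~ isfree (e, t, e0) ->
        expR (kap * (jump (e, t, e0))%:R) <= W j.
      rewrite /isfree/= -ltnNge => ltQ; apply: le_trans Wh; rewrite ler_expR.
      (* No free block fits, so [e + A <= Q < e + T + A] and the length of the target block lies in
         the window. *)
      have [_ /(_ (Q t e0 - e + B t e0 + 1)%N) QP2] := QP t e0.
      apply: le_trans (QP2 _) _; first by clear -eA ltQ; lia.
      rewrite ler_wpM2l// lerD2r.
      have : (Q t e0)%:R <= (e + T + A t e0)%:R :> R by rewrite ler_nat ltnW.
      by rewrite !natrD; clear; lra.
    split=> //; rewrite /step; case: ifPn => [fr|nfr]/=.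
      by rewrite natrD mulrDr addrK.
    apply: le_trans (jumpP nfr); rewrite ler_expR gerBl.
    by rewrite mulr_ge0.
  elim: k => [|k [e0e eA Wh Wk Wk']].
    have s0 : s 0%N = (0, 0, 0)%N by [].
    have [QA _] := QP 0%N 0%N.
    have W0 : W 0%N = 1 by rewrite /W big_ord0.
    have inv1 : expR (h * ((s 0%N).1.1%:R - (s 0%N).2%:R)) <= W 0%N.
      by rewrite s0/= subrr mulr0 expR0 W0.
    have inv2 : expR (kap * (s 0%N).1.1%:R) <= W 0%N.
      by rewrite s0/= mulr0 expR0 W0.
    by split => //; have [] := last_bound 0%N isT QA inv1 inv2.
  have [_ jumpP] := last_bound k e0e eA Wh Wk.
  have Wk0 : 0 <= W k by exact: le_trans (expR_ge0 _) Wk.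
  have sS : s k.+1 = step (s k) by [].
  have WS : W k.+1 = W k * (if isfree (s k) then K else 1)%:R.
    by rewrite /W big_ord_recr.
  have [f1 f2 f3 f4] : [/\ ((s k.+1).2 <= (s k.+1).1.1)%N,
    ((s k.+1).1.1 + A (s k.+1).1.2 (s k.+1).2 <=
       Q (s k.+1).1.2 (s k.+1).2)%N,
    expR (h * ((s k.+1).1.1%:R - (s k.+1).2%:R)) <= W k.+1 &
    expR (kap * (s k.+1).1.1%:R) <= W k.+1].
    rewrite sS WS /step; case: ifPn => [fr|nfr] /=.
      split => //.
      - by rewrite (leq_trans e0e)// leq_addr.
      - rewrite natrD addrAC mulrDr expRD.
        by apply: ler_pM; rewrite ?expR_ge0.
      - rewrite natrD mulrDr expRD; apply: ler_pM; rewrite ?expR_ge0//.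
        by apply: le_trans Kge; rewrite ler_expR ler_wpM2r.
    rewrite mulr1; split => //.
    - by have [] := QP (s k).1.2.+1 (jump (s k)).
    - rewrite subrr mulr0 expR0; apply: le_trans Wk.
      by rewrite -expR0 ler_expR mulr_ge0.
    - exact: jumpP.
  by split => //; have [] := last_bound _ f1 f2 f3 f4.
(* The target is fixed during a stage and each free block brings it nearer by [T > 0], so every
   stage ends. *)
have reach d k : (Q (s k).1.2 (s k).2 - (s k).1.1 <= d)%N ->
    exists k', ~~ isfree (s k') /\ (s k').1.2 = (s k).1.2.
  elim: d k => [|d IH] k Qd.
    exists k; split => //; rewrite /isfree -ltnNge.
    have [_ eA _ _ _] := inv k.
    by clear -Qd eA T0; lia.
  have [fr|nfr] := boolP (isfree (s k)); last by exists k.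
  have sS : s k.+1 = ((s k).1.1 + T, (s k).1.2, (s k).2)%N.
    by have -> : s k.+1 = step (s k) by []; rewrite /step fr.
  have [|k' [? kk']] := IH k.+1; last by exists k'; rewrite kk' sS.
  by rewrite sS/=; clear -Qd T0; lia.
exists (fun k => (s k).1.1), (fun k => (s k).1.2), (fun k => (s k).2),
  (fun k => isfree (s k)); split => //.
- move=> k; have sS : s k.+1 = step (s k) by [].
  have [_ eA _ _ _] := inv k.
  by case: ifPn => [fr|nfr]; rewrite sS /step ?fr ?(negbTE nfr).
- by move=> k; have [] := inv k.
have /choice[t0P fP] : forall t0, exists k, (s k).1.2 = t0.
  elim=> [|t0 [k kt]]; first by exists 0%N.
  have [k' [nfr k't]] := reach _ k (leqnn _).
  exists k'.+1; have -> : s k'.+1 = step (s k') by [].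
  by rewrite /step (negbTE nfr)/= k't kt.
move=> t0; have [k' [nfr k't]] := reach _ (t0P t0) (leqnn _).
by exists k'; rewrite k't fP.
Qed.

(** * Block and target data *)

Lemma iter_preimage (T : Type) (Y : set T) (g : T -> T) n y :
  g @` Y = Y -> Y y -> exists2 w, Y w & iter n g w = y.
Proof.
move=> gY; elim: n y => [|n IH] y Yy; first by exists y.
have : (g @` Y) y by rewrite gY.
move=> [y1 Yy1 <-]; have [w Yw wy1] := IH _ Yy1.
by exists w => //=; rewrite wy1.
Qed.

Lemma infinite_nat_ge (A : set nat) n0 :
  infinite_set A -> exists2 n, A n & (n0 <= n)%N.
Proof.
move=> infA; apply: contrapT => noA; apply: infA.
apply: (sub_finite_set _ (finite_II n0)) => n An /=.
by rewrite ltnNge; apply/negP => n0n; apply: noA; exists n.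
Qed.

Lemma infinite_nat (A : set nat) :
  (forall n0, exists2 n, A n & (n0 <= n)%N) -> infinite_set A.
Proof.
move=> unb finA; have /finite_seqP[F FA] := finA.
have [n An] := unb (\max_(i <- F) i).+1.
rewrite FA in An; rewrite ltnNge => /negP; apply.
exact: leq_bigmax_seq.
Qed.

Lemma eventually_gt_rate (R : realType) (phi : nat -> R) (t : R) :
  (forall n, 0 < phi n) -> (upper_rate phi < t%:E)%E ->
  exists n0, forall n, (n0 <= n)%N -> expR (- (t * n%:R)) < phi n.
Proof.
move=> phi0 /limn_esup_lt[n0 n0P]; exists n0.+1 => -[//|n] nn0.
have := n0P _ (ltnW nn0); rewrite lte_fin -mulNr ltr_pdivrMr ?ltr0n//.
by rewrite ltrNl => lt; rewrite -[ltRHS]lnK ?posrE// ltr_expR.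
Qed.

(** Gives the margin beyond which the exponential shadowing error is small. *)
Lemma lengths_exp_le (R : realType) (eps d l : R) : 0 < eps -> 0 < d -> 0 < l ->
  exists2 a : nat, (0 < a)%N & forall x, a%:R * l <= x -> eps * expR (- x) <= d.
Proof.
move=> eps0 d0 l0; exists (Num.truncn (ln (eps / d) / l)).+1 => // x ax.
rewrite -ler_pdivlMl// -[leRHS]lnK ?posrE ?mulr_gt0 ?invr_gt0// ler_expR lerNl.
rewrite mulrC -lnV ?posrE ?divr_gt0// invf_div.
apply: le_trans ax; rewrite -ler_pdivrMr//.
exact/ltW/truncnS_gt.
Qed.

(** The separated stretch is framed by margins that bring the shadowing error down to a quarter of
    the separation, so half of it survives. The factor [th] pays for margins and gap. *)
Lemma free_block (R : realType) (X : metricType R) (f : X -> X) (Y : set X)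
    (N : nat) (L h eps0 l1 l2 th : R) (p : nat -> nat) :
  (0 < N)%N -> 1 <= L ->
  (forall x y, mdist (f x) (f y) <= L * mdist x y) ->
  [set: X] = \bigcup_(l < N) (iter l f @` Y) -> Y !=set0 ->
  iter N f @` Y = Y ->
  0 <= h -> h = 0 \/ (h%:E < htop f [set: X])%E ->
  0 < l1 -> 0 < l2 -> 0 < eps0 -> 0 < th -> th < 1 ->
  (forall eta : R, 0 < eta -> exists n0, forall n, (n0 <= n)%N ->
    (p n)%:R <= eta * n%:R) ->
  exists (l K : nat) (u : nat -> X) (eps : R),
    [/\ 0 < eps, (0 < l)%N,
        expR (th * h * N%:R * (l + p l)%:R) <= K%:R,
        forall c, (c < K)%N -> Y (u c) &
        forall c c', (c < K)%N -> (c' < K)%N -> c <> c' ->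
          exists i, (0 < i < l)%N /\ forall w w',
            mdist (iter i (iter N f) (u c)) w <=
              eps0 * expR (- Num.min (i%:R * l1) ((l%:R - 1 - i%:R) * l2)) ->
            mdist (iter i (iter N f) (u c')) w' <=
              eps0 * expR (- Num.min (i%:R * l1) ((l%:R - 1 - i%:R) * l2)) ->
            eps <= mdist w w'].
Proof.
move=> N0 L1 Lf XY Y0 gY h0 hlt l10 l20 eps00 th0 th1 psub.
have [eps [M0 [epsgt sep]]] := separated_points N0 L1 Lf XY Y0 h0 hlt.
have e40 : 0 < eps / 4 by rewrite divr_gt0.
have [a a0 aP] := lengths_exp_le eps00 e40 l10.
have [b b0 bP] := lengths_exp_le eps00 e40 l20.
have [m M0m mP] := free_block_length a b M0 psub th0 th1.
have [K [y [Kge Yy sepy]]] := sep _ M0m.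
have /choice[u uP] : forall c, exists w, (c < K)%N ->
    Y w /\ iter a (iter N f) w = y c.
  move=> c; have [cK|cK] := boolP (c < K)%N; last by exists (y c).
  by have [w] := iter_preimage a gY (Yy _ cK); exists w.
exists (a + m + b)%N, K, u, (eps / 2); split.
- by rewrite divr_gt0.
- by rewrite -addnA addn_gt0 a0.
- apply: le_trans Kge; rewrite ler_expR natrM.
  have -> : th * h * N%:R * (a + m + b + p (a + m + b)%N)%:R =
    h * N%:R * (th * (a + m + b + p (a + m + b)%N)%:R).
    by rewrite !mulrA; congr (_ * _); rewrite mulrC mulrA mulrAC [_ * h]mulrC.
  by rewrite [leRHS]mulrA ler_wpM2l// mulr_ge0.
- by move=> c /uP[].
move=> c c' cK c'K cc'; have [i im epsi] := sepy _ _ cK c'K cc'.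
have [[_ uc] [_ uc']] := (uP _ cK, uP _ c'K).
(* [a > 0] makes the separating time positive, so a later shift by fewer than [N] steps does not
   lose it. *)
exists (i + a)%N; split.
  by rewrite addn_gt0 a0 orbT/= addnC -addnA ltn_add2l ltn_addr.
move=> w w'; rewrite !iterD uc uc'; set err := eps0 * _.
have errle : err <= eps / 4.
  rewrite /err; set xx := _ * l1; set yy := _ * l2.
  have [_|_] := leP xx yy.
    by apply: aP; rewrite ler_pM2r// ler_nat leq_addl.
  apply: bP; rewrite ler_pM2r//.
  have : (i.+1)%:R <= m%:R :> R by rewrite ler_nat.
  by rewrite -natr1 !natrD; clear; lra.
move=> cw c'w'.
have := metric_triangle (iter i (iter N f) (y c)) w (iter i (iter N f) (y c')).
have := metric_triangle w w' (iter i (iter N f) (y c')).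
move: cw c'w' epsi errle; rewrite (metric_sym w' (iter i _ _)); clear; lra.
Qed.

(** The residue of [mu] modulo [N] is a shift common to all targets. It turns the hitting time [sv]
    into [N * Q + I1]; as the target is [f^I1 y], it suffices to be near [y] at time [Q] of
    [f^N]. *)
Lemma target_data (R : realType) (X : metricType R) (f : X -> X) (Y : set X)
    (N T : nat) (L eps0 l1 l2 t kap th : R) (p : nat -> nat)
    (phi : nat -> R) (z : nat -> X) (s : nat -> nat) (mu : int) :
  (0 < N)%N -> 1 <= L -> 0 < l1 -> 0 < l2 -> 0 < eps0 ->
  (forall eta : R, 0 < eta -> exists n0, forall n, (n0 <= n)%N ->
    (p n)%:R <= eta * n%:R) ->
  0 <= t -> 0 <= kap -> 0 < th -> t < l1 ->
  kap * (1 + t / l2) < th * (1 - t / l1) ->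
  (forall n, 0 < phi n) -> (upper_rate phi < t%:E)%E ->
  s i @[i --> \oo] --> \oo -> Ind' f N z s Y mu ->
  forall e0 n0, exists (Q A B I1 sv : nat) (y : X),
    [/\ [/\ Y y, range s sv, (n0 <= sv)%N & z sv = iter I1 f y],
        (I1 < N)%N, (sv + `|(mu %% N%:Z)%Z| = N * Q + I1)%N,
        L ^+ N * (eps0 * expR (- Num.min (A%:R * (N%:R * l1))
          (B%:R * (N%:R * l2)))) < phi sv &
        (e0 + A <= Q)%N /\
        forall n, (A + B + 1 <= n <= A + T + B + 1)%N ->
          kap * (Q + B + 1 + p n)%:R <= th * (Q%:R - A%:R - T%:R - e0%:R)].
Proof.
move=> N0 L1 l10 l20 eps00 psub t0 kap0 th0 tl1 gap phi0 phit soo.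
move=> [[I1 I2] /= [I1N I2N infI] <-] e0 n0.
have LN0 : 0 < L ^+ N by rewrite exprn_gt0// (lt_le_trans ltr01).
(* [C] absorbs the factor [L ^+ N * eps0]; the added 1 makes the final inequality strict. *)
pose C := `|ln (L ^+ N * eps0)| + 1.
have C0 : 0 <= C by rewrite addr_ge0.
have [S0 S0P] := @target_window R p N T l1 l2 t kap th C psub N0 l10 l20 t0 kap0
  th0 tl1 gap C0 e0.
have [n1 n1P] := eventually_gt_rate phi0 phit.
have [i0 _ i0P] : (s @ \oo)
    [set n | (maxn (maxn S0 n1) (maxn n0 (N + N)) <= n)%N].
  by apply: soo; exists (maxn (maxn S0 n1) (maxn n0 (N + N))).
have [i [[y Yy zy] dvdN] i0i] := infinite_nat_ge i0 infI.
have := i0P _ i0i; rewrite /= !geq_max.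
set sv := s i; move=> /andP[/andP[S0s n1s] /andP[n0s Ns]].
pose r := `|((I1%:Z - I2%:Z) %% N%:Z)%Z|%N.
have rE : r%:Z = ((I1%:Z - I2%:Z) %% N%:Z)%Z.
  by rewrite /r gez0_abs// modz_ge0// eqz_nat -lt0n.
have rN : (r < N)%N by rewrite -ltz_nat rE ltz_pmod.
have [Q QE] : exists Q, (sv + r = N * Q + I1)%N.
  have [d dE] := dvdzP dvdN.
  have mE := divz_eq (I1%:Z - I2%:Z) N%:Z.
  rewrite -rE in mE.
  set dd := ((I1%:Z - I2%:Z) %/ N%:Z)%Z in mE *.
  have eqZ : sv%:Z + r%:Z = N%:Z * (d - dd) + I1%:Z.
    have -> : sv%:Z = d * N%:Z + I2%:Z by rewrite -dE subrK.
    have -> : r%:Z = I1%:Z - I2%:Z - dd * N%:Z.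
      by rewrite {1}mE addrAC subrr add0r.
    by ring.
  (* The bound [N + N <= sv] keeps this quotient non-negative, so it is a time. *)
  have dd0 : 0 <= d - dd.
    rewrite -(@pmulr_rge0 _ N%:Z)// -(lerD2r I1%:Z) -eqZ add0r -PoszD lez_nat.
    rewrite (leq_trans (ltnW I1N))// (leq_trans (leq_addr N N))//.
    by rewrite (leq_trans Ns)// leq_addr.
  exists `|d - dd|%N; apply/eqP; rewrite -eqz_nat; apply/eqP.
  by rewrite PoszD eqZ PoszD PoszM gez0_abs.
have [|||A [B [AC BC eA win]]] := S0P sv Q.
- exact: S0s.
- rewrite -(leq_add2r r) QE -addnA leq_add2l.
  by rewrite (leq_trans (ltnW I1N))// leq_addr.
- by rewrite (leq_trans (leq_addr I1 _))// -QE leq_add2l ltnW.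
exists Q, A, B, I1, sv, y; split => //; first by split => //; exists i.
apply: lt_trans (n1P _ n1s).
rewrite mulrA -[L ^+ N * eps0]lnK ?posrE ?mulr_gt0// -expRD ltr_expR.
have : C + t * sv%:R <= Num.min (A%:R * (N%:R * l1)) (B%:R * (N%:R * l2)).
  by rewrite le_min AC BC.
have := ler_norm (ln (L ^+ N * eps0)); rewrite /C.
by move: (Num.min _ _) `|_|; clear => u v; lra.
Qed.

(** * The tree of points in the target set *)

Definition is_branch (M sg : nat -> nat) : Prop := forall j, (sg j < M j)%N.

(* The even coordinates of a branch choose the blocks after time 0, the odd ones
   the blocks before it, which are seen by the inverse of [f]. *)
Definition orbit_separation (R : realType) (X : metricType R) (M : nat -> nat)
    (x : (nat -> nat) -> X) (F : X -> X) (eps r C : R) (b : bool) : Prop :=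
  forall n : nat, exists J : seq nat,
    [/\ uniq J, {in J, forall j, odd j = b},
        \prod_(j <- J) (M j)%:R^-1 <= C * expR (- (r * n%:R)) &
        forall sg sg', is_branch M sg -> is_branch M sg' ->
          (forall i, (i < n)%N ->
             mdist (iter i F (x sg)) (iter i F (x sg')) < eps) ->
          {in J, sg =1 sg'}].

Lemma entropy_factorE (R : realType) (l1 l2 tau : R) :
  0 < l1 -> 0 < l2 -> 0 <= tau ->
  entropy_factor l1 l2 tau = (1 - tau / l1) / (1 + tau / l2).
Proof.
move=> l10 l20 t0; rewrite /entropy_factor.
have l2t : 0 < l2 + tau by rewrite ltr_wpDr.
by field; rewrite !gt_eqF// -?mulrDr ?mulr_gt0.
Qed.

Lemma entropy_factor_gt0 (R : realType) (l1 l2 tau : R) :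
  0 < l1 -> 0 < l2 -> 0 <= tau -> tau < l1 -> 0 < entropy_factor l1 l2 tau.
Proof.
move=> l10 l20 t0 tl1; rewrite entropy_factorE// divr_gt0//.
  by rewrite subr_gt0 ltr_pdivrMr// mul1r.
by rewrite ltr_wpDr// divr_ge0// ltW.
Qed.

Lemma entropy_factor_le1 (R : realType) (l1 l2 tau : R) :
  0 < l1 -> 0 < l2 -> 0 <= tau -> entropy_factor l1 l2 tau <= 1.
Proof.
move=> l10 l20 t0; rewrite entropy_factorE// ler_pdivrMr; last first.
  by rewrite ltr_wpDr// divr_ge0// ltW.
rewrite mul1r; apply: (@le_trans _ _ 1).
  by rewrite gerBl divr_ge0// ltW.
by rewrite lerDl divr_ge0// ltW.
Qed.

(** At [t = tau] the two sides are [1 - tau / l1] times [th] and [(1 + th) / 2], so the inequality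
    is strict there and persists slightly above [tau]. *)
Lemma rate_slack (R : realType) (l1 l2 tau th : R) :
  0 < l1 -> 0 < l2 -> 0 <= tau -> tau < l1 -> 0 < th -> th < 1 ->
  exists t, [/\ tau < t, t < l1 &
    th * entropy_factor l1 l2 tau * (1 + t / l2) < (1 + th) / 2 * (1 - t / l1)].
Proof.
move=> l10 l20 tau0 taul1 th0 th1; set c := entropy_factor _ _ _.
have c0 : 0 < c by exact: entropy_factor_gt0.
have cE : c * (1 + tau / l2) = 1 - tau / l1.
  rewrite /c entropy_factorE// divfK// gt_eqF// ltr_wpDr// divr_ge0//.
  exact: ltW.
clearbody c.
have a0 : 0 < 1 - tau / l1 by rewrite subr_gt0 ltr_pdivrMr// mul1r.
(* [D] is the room at [tau], and [k] the speed at which it shrinks as [t] grows. *)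
pose D := (1 - th) / 2 * (1 - tau / l1).
have D0 : 0 < D by rewrite mulr_gt0// divr_gt0// subr_gt0.
pose k := th * c / l2 + (1 + th) / 2 / l1.
have k0 : 0 < k.
  by apply: addr_gt0; rewrite !divr_gt0 ?mulr_gt0 ?addr_gt0.
pose d := Num.min ((l1 - tau) / 2) (D / (2 * k)).
have d0 : 0 < d by rewrite lt_min !divr_gt0 ?mulr_gt0// subr_gt0.
have d1 : d <= (l1 - tau) / 2 by rewrite ge_min lexx.
have d2 : d * k < D.
  rewrite -ltr_pdivlMr// (@le_lt_trans _ _ (D / (2 * k)))//.
    by rewrite ge_min lexx orbT.
  by rewrite ltr_pM2l// ltf_pV2 ?posrE ?mulr_gt0// ltr_pMl// ltr1n.
exists (tau + d); split; [by rewrite ltrDl|by move: d1 taul1; clear; lra|].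
have -> : th * c * (1 + (tau + d) / l2) = th * (1 - tau / l1) + th * c / l2 * d.
  by rewrite -cE; field; rewrite gt_eqF.
have -> : (1 + th) / 2 * (1 - (tau + d) / l1) =
    (1 + th) / 2 * (1 - tau / l1) - (1 + th) / 2 / l1 * d.
  by field; rewrite gt_eqF.
by move: d2; rewrite /k /D; clear; lra.
Qed.

(** The blocks follow [timeline] for [f^N], and [x sg] is the image under [f^r] of a point of [Y]
    shadowing the blocks selected by [sg]. One branch space serves both directions of time, so that
    their letters can be combined. *)
Lemma moran_family (R : realType) (X : metricType R) (f : X -> X)
    (Y : set X) (N : nat) (L l1 l2 eps0 tau h th : R)
    (phi : nat -> nat -> R) (z : nat -> nat -> X) (s : nat -> nat -> nat)
    (mu : int) :
  compact Y -> Y !=set0 -> continuous f -> (0 < N)%N -> 1 <= L ->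
  (forall x y, mdist (f x) (f y) <= L * mdist x y) ->
  iter N f @` Y = Y ->
  [set: X] = \bigcup_(l < N) (iter l f @` Y) ->
  0 < l1 -> 0 < l2 -> 0 < eps0 ->
  exp_specification Y (iter N f) (N%:R * l1) (N%:R * l2) eps0 ->
  (forall j, (1 <= j)%N -> forall n, 0 < phi j n) ->
  (forall j, (1 <= j)%N -> s j i @[i --> \oo] --> \oo) ->
  (forall j, (1 <= j)%N -> (upper_rate (phi j) <= tau%:E)%E) ->
  0 <= tau -> tau < l1 ->
  (forall j, (1 <= j)%N -> Ind' f N (z j) (s j) Y mu) ->
  0 <= h -> h = 0 \/ (h%:E < htop f [set: X])%E ->
  0 < th -> th < 1 ->
  exists (M : nat -> nat) (x : (nat -> nat) -> X) (eps C : R),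
    [/\ [/\ 0 < eps, 0 < C & forall j, (0 < M j)%N],
        forall sg, is_branch M sg -> forall j, (1 <= j)%N ->
          shrinking_target f (phi j) (z j) (range (s j)) (x sg),
        orbit_separation M x f eps (th * entropy_factor l1 l2 tau * h) C false &
        forall fi, continuous fi -> cancel f fi ->
          orbit_separation M x fi eps (th * h) C true].
Proof.
move=> cY Y0 fc N0 L1 Lf gY XY l10 l20 eps00 [p [p0 plim spec]].
move=> phi0 soo phit tau0 taul1 IndP h0 hlt th0 th1.
set c := entropy_factor l1 l2 tau.
have c0 : 0 < c by exact: entropy_factor_gt0.
have c1 : c <= 1 by exact: entropy_factor_le1.
have NR0 : 0 < N%:R :> R by rewrite ltr0n.
have psub := sublinear_gap plim.
set g := iter N f.
have gc : continuous g by exact: iter_continuous.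
have [t [taut tl1 gap]] := rate_slack l10 l20 tau0 taul1 th0 th1.
have tautE : (tau%:E < t%:E)%E by rewrite lte_fin.
have t0 : 0 <= t by rewrite (le_trans tau0)// ltW.
(* Free blocks are produced at rate [th' * h]; the excess over [th] leaves room for [t > tau]. *)
pose th' := (1 + th) / 2.
have [th'0 th'1 thth'] : [/\ 0 < th', th' < 1 & th <= th'].
  by split; rewrite /th'; lra.
have [l [K [u [eps [eps_gt0 lgt0 Kge uY usep]]]]] :=
  free_block N0 L1 Lf XY Y0 gY h0 hlt (mulr_gt0 NR0 l10) (mulr_gt0 NR0 l20)
    eps00 th'0 th'1 psub.
set T := (l + p l)%N in Kge.
have T0 : (0 < T)%N by rewrite addn_gt0 lgt0.
have K0 : (0 < K)%N.
  by rewrite -(ltr_nat R) (lt_le_trans _ Kge)// expR_gt0.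
(* stage [pickle (j, n0)] hits the [j.+1]-st target at a time [>= n0] *)
pose stage t0 := odflt (0, 0)%N (@unpickle (nat * nat)%type t0).
pose r := `|(mu %% N%:Z)%Z|%N.
have kap0 : 0 <= th * c by rewrite mulr_ge0// ltW.
have kap_le : th * c <= th'.
  by rewrite (le_trans _ thth')// ler_piMr// ltW.
have /choice[tgt tgtP] : forall te : nat * nat,
    exists d : nat * nat * nat * nat * nat * X,
    let '(Q, A, B, I1, sv, y) := d in let j := (stage te.1).1.+1 in
    [/\ [/\ Y y, range (s j) sv, ((stage te.1).2 <= sv)%N &
            z j sv = iter I1 f y],
        (I1 < N)%N, (sv + r = N * Q + I1)%N,
        L ^+ N * (eps0 * expR (- Num.min (A%:R * (N%:R * l1))
          (B%:R * (N%:R * l2)))) < phi j sv &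
        (te.2 + A <= Q)%N /\
        forall n, (A + B + 1 <= n <= A + T + B + 1)%N ->
          th * c * (Q + B + 1 + p n)%:R <=
          th' * (Q%:R - A%:R - T%:R - te.2%:R)].
  move=> [t1 e0]; set j := (stage t1).1.+1.
  have [Q [A [B [I1 [sv [y P]]]]]] := @target_data R X f Y N T L eps0 l1 l2 t
    (th * c) th' p (phi j) (z j) (s j) mu N0 L1 l10 l20 eps00 psub t0 kap0 th'0
    tl1 gap (phi0 j isT) (le_lt_trans (phit j isT) tautE) (soo j isT)
    (IndP j isT) e0 (stage t1).2.
  by exists (Q, A, B, I1, sv, y).
pose hh := h * N%:R.
have hh0 : 0 <= hh by rewrite mulr_ge0// ltW.
pose Q t e0 := let '(Q, A, B, I1, sv, y) := tgt (t, e0) in Q.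
pose A t e0 := let '(Q, A, B, I1, sv, y) := tgt (t, e0) in A.
pose B t e0 := let '(Q, A, B, I1, sv, y) := tgt (t, e0) in B.
pose y t e0 := let '(Q, A, B, I1, sv, y) := tgt (t, e0) in y.
have yY t1 e0 : Y (y t1 e0).
  have := tgtP (t1, e0); rewrite /y.
  by case: (tgt _) => -[[[[? ?] ?] ?] ?] ? [[]].
have [||||e [ti [e0 [free [e00 eS ew eh]]]]] :=
    @timeline R T K p Q A B (th * c * hh) (th' * hh) T0.
- by rewrite mulr_ge0.
- by rewrite ler_wpM2r.
- by apply: le_trans Kge; rewrite /hh !mulrA.
- move=> t1 e1; have := tgtP (t1, e1); rewrite /Q /A /B.
  case: (tgt _) => -[[[[Q1 A1] B1] I1] sv] y1 [_ _ _ _ [? win]].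
  split => // n nP.
  by rewrite mulrAC [leRHS]mulrAC ler_wpM2r// win.
(* A target block starts at a preimage that reaches [y] exactly at the target time [Q]. *)
have /choice[w wP] : forall k, exists w, Y w /\
    (~~ free k -> iter (Q (ti k) (e0 k) - e k) g w = y (ti k) (e0 k)).
  move=> k; have [w] := iter_preimage (Q (ti k) (e0 k) - e k) gY
    (yY (ti k) (e0 k)).
  by exists w.
(* A target block has [Q - e] steps before the target, the target itself and [B] steps after it. *)
pose n k :=
  if free k then l else (Q (ti k) (e0 k) - e k + B (ti k) (e0 k) + 1)%N.
have eE k : e k = (\sum_(j < k) (n j + p (n j)))%N.
  elim: k => [|k IH]; first by rewrite e00 big_ord0.
  rewrite big_ord_recr/= -IH /n; have := eS k; case: (free k) => // -[eQ ->].
  set P := p _; move: eQ; clear; lia.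
(* A target block has a single letter; blocks before time 0 are all free. *)
pose M j := if odd j then K else if free j./2 then K else 1%N.
have M0 j : (0 < M j)%N by rewrite /M; case: ifP => // _; case: ifP.
have Meven k : M k.*2 = if free k then K else 1%N.
  by rewrite /M odd_double doubleK.
have Modd k : M k.*2.+1 = K by rewrite /M/= odd_double.
pose xf (sg : nat -> nat) k := if free k then u (sg k.*2) else w k.
pose err k i := eps0 * expR (- Num.min (i%:R * (N%:R * l1))
  (((n k)%:R - 1 - i%:R) * (N%:R * l2))).
pose errb i := eps0 * expR (- Num.min (i%:R * (N%:R * l1))
  ((l%:R - 1 - i%:R) * (N%:R * l2))).
have /choice[v vP] : forall sg, exists v, is_branch M sg -> [/\ Y v,
    forall k i, (i < n k)%N ->
      mdist (iter i g (xf sg k)) (iter (e k + i) g v) <= err k i &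
    forall gi, continuous gi -> cancel g gi -> forall k i, (i < l)%N ->
      mdist (iter i g (u (sg k.*2.+1))) (iter (k.+1 * T - i) gi v) <= errb i].
  move=> sg; have [sgM|nsg] := pselect (is_branch M sg); last first.
    by have [y0 _] := Y0; exists y0.
  have [||||v [Yv vf vb]] := two_sided_shadowing spec cY gc (x := xf sg)
      (xb := fun k => u (sg k.*2.+1)) (n := n) (q := fun k => p (n k))
      (l := l) (q' := p l).
  - move=> k; split => //.
      rewrite /xf; have := sgM k.*2; rewrite Meven.
      by case: (free k) => [/uY//|_]; have [] := wP k.
    by rewrite /n; case: ifP => // _; rewrite addn1.
  - by move=> k; apply: uY; have := sgM k.*2.+1; rewrite Modd.
  - exact: lgt0.
  - exact: leqnn.
  by exists v => _; split => // k i ik; rewrite eE; exact: vf.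
have rN : (r < N)%N.
  rewrite -ltz_nat /r gez0_abs; last by rewrite modz_ge0// eqz_nat -lt0n.
  by rewrite ltz_pmod.
have e_lt k : (e k < e k.+1)%N.
  have := eS k; case: (free k) => [->|[eQ ->]].
    by rewrite -addn1 leq_add2l.
  rewrite [(_ + _ + 1)%N]addn1 addSn ltnS -addnA.
  rewrite (leq_trans (leq_addr (A (ti k) (e0 k)) _))// (leq_trans eQ)//.
  exact: leq_addr.
have sep_fwd sg sg' k : is_branch M sg -> is_branch M sg' ->
    sg k.*2 <> sg' k.*2 -> exists i, [/\ (0 < i)%N, (i < e k.+1)%N &
      eps <= mdist (iter i g (v sg)) (iter i g (v sg'))].
  move=> sgM sgM' ne; have := sgM k.*2; have := sgM' k.*2; rewrite Meven.
  have := eS k; case fr: (free k); last first.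
    by rewrite !ltnS !leqn0 => _ /eqP s1 /eqP s2; case: ne; rewrite s1 s2.
  move=> ek sgk' sgk; have [i [/andP[i0 il] iP]] := usep _ _ sgk sgk' ne.
  exists (e k + i)%N; split.
  - by rewrite addn_gt0 i0 orbT.
  - by rewrite ek ltn_add2l ltn_addr.
  have nl : n k = l by rewrite /n fr.
  have [_ vf _] := vP _ sgM; have [_ vf' _] := vP _ sgM'.
  have := vf k i; have := vf' k i; rewrite nl /err nl /xf fr.
  by move=> /(_ il) ? /(_ il) ?; exact: iP.
have sep_bwd gi sg sg' k : continuous gi -> cancel g gi ->
    is_branch M sg -> is_branch M sg' ->
    sg k.*2.+1 <> sg' k.*2.+1 -> exists i, (i < k.+1 * T)%N /\
      eps <= mdist (iter i gi (v sg)) (iter i gi (v sg')).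
  move=> gic gK sgM sgM' ne; have := sgM k.*2.+1; have := sgM' k.*2.+1.
  rewrite Modd => sgk' sgk; have [i [/andP[i0 il] iP]] := usep _ _ sgk sgk' ne.
  exists (k.+1 * T - i)%N; split.
    by rewrite ltn_subrL i0 muln_gt0 T0.
  have [_ _ vb] := vP _ sgM; have [_ _ vb'] := vP _ sgM'.
  by apply: iP; [exact: vb|exact: vb'].
(* The constant pays for the unfinished last block, in either direction of time. *)
exists M, (fun sg => iter r f (v sg)), eps, (expR (th' * hh * T%:R)).
split; first by split; rewrite ?expR_gt0.
- move=> sg sgM j j1; apply: infinite_nat => n0.
  have [k [nfr tk]] := eh (pickle (j.-1, n0)).
  have st : stage (ti k) = (j.-1, n0) by rewrite /stage tk pickleK.
  have [_ vf _] := vP _ sgM.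
  have := vf k (Q (ti k) (e0 k) - e k)%N; have := tgtP (ti k, e0 k).
  have [_ /(_ nfr)] := wP k; have := eS k.
  rewrite /err /xf /n (negbTE nfr) /Q /A /B /y.
  case: (tgt _) => -[[[[Q1 A1] B1] I1] sv] y1.
  rewrite st/= prednK// => -[eQ _] wy [[Yy rsv n0s zy] I1N sQ close _].
  rewrite wy subnKC; last by rewrite (leq_trans _ eQ)// leq_addr.
  rewrite addn1 ltnS leq_addr => /(_ isT) vy.
  exists sv => //; split => //; rewrite -iterD sQ zy.
  rewrite addnC mulnC iterD iterM -/g metric_sym.
  apply: le_lt_trans close.
  apply: le_trans (mdist_iter_le_max _ _ L1 Lf (ltnW I1N)) _.
  rewrite ler_pM2l ?exprn_gt0 ?(lt_le_trans ltr01)//.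
  apply: le_trans vy _; rewrite ler_pM2l// ler_expR lerN2.
  (* The target is at least [A] steps after the start of its block and exactly [B] before the
     end. *)
  rewrite le_min !ge_min; apply/andP; split; apply/orP.
    left; rewrite ler_pM2r ?mulr_gt0// ler_nat; move: eQ; clear; lia.
  right; rewrite ler_pM2r ?mulr_gt0// -natr1 natrD addrK.
  by rewrite addrC addKr.
- move=> m.
  (* [m] steps of [f] determine the [k] blocks already finished, while the mass bound is stated at
     [e k.+1]. *)
  have [k /andP[ek_le ek_gt]] : exists k, (N * e k <= m < N * e k.+1)%N.
    elim: m => [|m [k /andP[m1 m2]]].
      have := e_lt 0%N; rewrite e00 => e1.
      by exists 0%N; rewrite e00 muln0 muln_gt0 N0.
    have [m3|m3] := ltnP m.+1 (N * e k.+1)%N.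
      by exists k; rewrite m3 (leq_trans m1).
    exists k.+1; rewrite m3 (leq_ltn_trans m2)//.
    by rewrite ltn_pmul2l.
  have e_mono i : (i <= k)%N -> (e i <= e k)%N.
    move=> ik; rewrite -(subnKC ik); elim: (k - i)%N => [|d IH].
      by rewrite addn0.
    by rewrite addnS (leq_trans IH)// ltnW.
  exists [seq i.*2 | i <- iota 0 k]; split.
  - by rewrite (map_inj_uniq double_inj) iota_uniq.
  - by move=> _ /mapP[i _ ->]; rewrite odd_double.
  - rewrite big_map (_ : iota 0 k = index_iota 0 k); last first.
      by rewrite /index_iota subn0.
    rewrite big_mkord prodfV.
    under eq_bigr do rewrite Meven.
    have W0 := lt_le_trans (expR_gt0 _) (ew k).
    rewrite -lef_pV2 ?posrE ?invr_gt0// ?mulr_gt0 ?expR_gt0// invrK.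
    apply: le_trans (ew k); rewrite -expRD -expRN ler_expR.
    have mk : m%:R <= N%:R * (e k.+1)%:R :> R by rewrite -natrM ler_nat ltnW.
    have := ler_wpM2l (mulr_ge0 kap0 h0) mk.
    have := ler_wpM2r (ler0n R T) (ler_wpM2r hh0 kap_le).
    by rewrite /hh; clear; lra.
  - move=> sg sg' sgM sgM' close _ /mapP[i ik ->].
    apply: contrapT => /(sep_fwd _ _ _ sgM sgM')[t1 [t10 t1e]].
    apply/negP; rewrite -ltNge.
    have rNt : (r <= t1 * N)%N by rewrite (leq_trans (ltnW rN))// leq_pmull.
    (* [x sg] is [r] steps ahead of [v sg]; as [r < N] and [t1 > 0], the separating time stays
       non-negative. *)
    have it w1 : iter t1 g w1 = iter (t1 * N - r) f (iter r f w1).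
      by rewrite -iterD subnK// iterM.
    rewrite !it; apply: close; rewrite (leq_ltn_trans (leq_subr _ _))//.
    rewrite (leq_trans _ ek_le)// mulnC ltn_pmul2l//.
    rewrite (leq_trans t1e)// e_mono//.
    by move: ik; rewrite mem_iota.
- move=> fi fic fK m.
  have gic : continuous (iter N fi) by exact: iter_continuous.
  have gK : cancel g (iter N fi) by exact: iter_cancel.
  have NT0 : (0 < N * T)%N by rewrite muln_gt0 N0.
  pose k := (m %/ (N * T))%N.
  have km : (k * (N * T) <= m)%N by rewrite leq_trunc_div.
  have mk : (m < k.+1 * (N * T))%N by rewrite -ltn_divLR.
  exists [seq i.*2.+1 | i <- iota 0 k]; split.
  - by rewrite map_inj_uniq ?iota_uniq// => i i' [] /double_inj.
  - by move=> _ /mapP[i _ ->]; rewrite /= odd_double.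
  - rewrite big_map (_ : iota 0 k = index_iota 0 k); last first.
      by rewrite /index_iota subn0.
    rewrite big_mkord; under eq_bigr do rewrite Modd.
    rewrite prodr_const card_ord exprVn.
    have Kk : expR (th' * hh * T%:R * k%:R) <= K%:R ^+ k.
      rewrite mulrC expRM_natl lerXn2r ?nnegrE ?expR_ge0 ?ler0n//.
      by apply: le_trans Kge; rewrite /hh !mulrA.
    have W0 := lt_le_trans (expR_gt0 _) Kk.
    rewrite -lef_pV2 ?posrE ?invr_gt0// ?mulr_gt0 ?expR_gt0// invrK.
    apply: le_trans Kk; rewrite -expRD -expRN ler_expR.
    have mk' : m%:R <= (k%:R + 1) * (N%:R * T%:R) :> R.
      by rewrite natr1 -!natrM ler_nat ltnW.
    have h1 : th * h * m%:R <= th' * h * m%:R.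
      by rewrite ler_wpM2r// ler_wpM2r.
    have := ler_wpM2l (mulr_ge0 (ltW th'0) h0) mk'.
    by move: h1; rewrite /hh; clear; lra.
  - move=> sg sg' sgM sgM' close _ /mapP[i ik ->].
    apply: contrapT => /(sep_bwd _ _ _ _ gic gK sgM sgM')[t1 [t1T]].
    apply/negP; rewrite -ltNge.
    (* Backwards the shift has to be undone first, which costs fewer than [N] further steps. *)
    have it w1 : iter t1 (iter N fi) w1 = iter (t1 * N + r) fi (iter r f w1).
      by rewrite iterD iter_cancel// iterM.
    rewrite !it; apply: close.
    rewrite (@leq_trans (t1.+1 * N)%N)//.
      by rewrite mulSn addnC ltn_add2r.
    rewrite (leq_trans _ km)// [(N * T)%N]mulnC mulnA leq_pmul2r//.
    rewrite (leq_trans t1T)// leq_pmul2r//.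
    by move: ik; rewrite mem_iota.
Qed.

(** * Lower bounds *)

Lemma htop_ge_separation (R : realType) (X : metricType R) (f : X -> X)
    (Z : set X) (M : nat -> nat) (x : (nat -> nat) -> X) (eps r C : R) b :
  0 < eps -> 0 < C -> (forall j, (0 < M j)%N) ->
  (forall sg, is_branch M sg -> Z (x sg)) ->
  orbit_separation M x f eps r C b -> (r%:E <= htop f Z)%E.
Proof.
move=> eps0 C0 M0 xZ sep.
(* Orbits of two points in a Bowen ball of radius [eps / 2] are [eps]-close. *)
apply: (@htop_ge _ _ _ _ _ (eps / 2) (2 * C)^-1); rewrite ?divr_gt0//.
  by rewrite invr_gt0 mulr_gt0.
move=> D c n cov; apply: (@mass_distribution _ _ M x D
  (fun i => bowen_ball (n i) (c i) (eps / 2) f)) => //.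
- by move=> sg /xZ/cov[i]; exists i.
move=> i eta Di eta0; have [J [uJ _ massJ agree]] := sep (n i).
exists J; split => //.
  move=> sg sg' sgM sgM' U U'; apply: agree => // k kn.
  apply: le_lt_trans (metric_triangle _ (iter k f (c i)) _) _.
  rewrite (splitr eps) metric_sym ltrD//; [exact: U|exact: U'].
rewrite -EFinM -EFinD lee_fin mulNr; apply: le_trans massJ _.
by rewrite lerDl ltW.
Qed.

Lemma hausdorff_dim_ge_separation (R : realType) (X : metricType R)
    (Z : set X) (M : nat -> nat) (x : (nat -> nat) -> X) (C a : R) :
  0 < C -> 0 < a -> (forall j, (0 < M j)%N) ->
  (forall sg, is_branch M sg -> Z (x sg)) ->
  (forall d, 0 < d -> exists J : seq nat,
    [/\ uniq J, \prod_(j <- J) (M j)%:R^-1 <= C * d `^ a &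
        forall sg sg', is_branch M sg -> is_branch M sg' ->
          mdist (x sg) (x sg') <= d -> {in J, sg =1 sg'}]) ->
  (a%:E <= hausdorff_dim Z)%E.
Proof.
move=> C0 a0 M0 xZ sep.
apply: (@hausdorff_dim_ge _ _ _ _ 1 (2 * C)^-1) => //.
  by rewrite invr_gt0 mulr_gt0.
move=> D U diamU cov; apply: (@mass_distribution _ _ M x D U) => //.
- by move=> i; exact: poweR_ge0.
- by move=> sg /xZ/cov[i]; exists i.
move=> i eta Di eta0.
have [d dE] : exists d, diam (U i) = d%:E.
  by have := diamU _ Di; have := diam_ge0 (U i);
    case: (diam _) => [d| |]//; exists d.
have d0 : 0 <= d by rewrite -lee_fin -dE diam_ge0.
(* A set of diameter 0 is treated with a positive [d'] whose contribution is exactly [eta]. *)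
have [d' [d'0 dd' d'P]] : exists d', [/\ 0 < d', d <= d' &
    C * d' `^ a <= C * d `^ a + eta].
  move: d0; rewrite le_eqVlt => /predU1P[<-|d0]; last first.
    by exists d; rewrite d0 lexx lerDl ltW.
  exists ((eta / C) `^ a^-1); rewrite powR_gt0 ?divr_gt0// powR_ge0.
  split => //; rewrite -powRrM mulVf ?gt_eqF// powRr1; last first.
    by rewrite divr_ge0// ltW.
  by rewrite powR0 ?gt_eqF// mulr0 add0r [leLHS]mulrC divfK ?gt_eqF.
have [J [uJ massJ agree]] := sep _ d'0; exists J; split => //.
  move=> sg sg' sgM sgM' Us Us'; apply: agree => //.
  by apply: le_trans dd'; rewrite -lee_fin -dE; exact: mdist_le_diam.
by rewrite dE /= -EFinM -EFinD lee_fin (le_trans massJ).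
Qed.

(** Points at distance at most [d] stay [eps]-close for about [ln (eps / d) / ln L] steps. *)
Lemma orbit_separation_dist (R : realType) (X : metricType R) (F : X -> X)
    (M : nat -> nat) (x : (nat -> nat) -> X) (L eps r C : R) b :
  0 < eps -> 0 < C -> 0 <= r -> 1 < L ->
  (forall x y, mdist (F x) (F y) <= L * mdist x y) ->
  orbit_separation M x F eps r C b ->
  exists2 C', 0 < C' & forall d, 0 < d -> exists J : seq nat,
    [/\ uniq J, {in J, forall j, odd j = b},
        \prod_(j <- J) (M j)%:R^-1 <= C' * d `^ (r / ln L) &
        forall sg sg', is_branch M sg -> is_branch M sg' ->
          mdist (x sg) (x sg') <= d -> {in J, sg =1 sg'}].
Proof.
move=> eps0 C0 r0 L1 LF sep.
have L0 : 0 < L by exact: lt_trans L1.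
have lnL : 0 < ln L by exact: ln_gt0.
(* The term [r] pays for rounding [q] down, the other one for the scale [eps]. *)
exists (C * expR (r - r / ln L * ln eps)); first by rewrite mulr_gt0 ?expR_gt0.
move=> d d0; pose q := ln (eps / d) / ln L; pose n := Num.truncn q.
have [J [uJ bJ massJ agree]] := sep n; exists J; split => //.
- apply: le_trans massJ _; rewrite -[leRHS]mulrA ler_pM2l//.
  rewrite /powR gt_eqF// -expRD ler_expR.
  have qn : q <= n%:R + 1 by rewrite natr1 ltW// truncnS_gt.
  have := ler_wpM2l r0 qn.
  have -> : r * q = r / ln L * ln eps - r / ln L * ln d.
    by rewrite /q ln_div ?posrE//; field; rewrite gt_eqF.
  by clear; lra.
move=> sg sg' sgM sgM' dle; apply: agree => // i i_n.
(* A negative [q] would give [n = 0] and leave no [i < n]. *)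
have q0 : 0 <= q.
  rewrite leNgt; apply/negP => q0; move: i_n; rewrite /n.
  rewrite (_ : Num.truncn q = 0%N)//; apply/eqP.
  by rewrite -leqn0 truncn_le_nat (lt_trans q0).
have Lnd : L ^+ n * d <= eps.
  rewrite -ler_pdivlMr// -[L]lnK ?posrE// -expRM_natl.
  rewrite -[leRHS]lnK ?posrE ?divr_gt0// ler_expR -ler_pdivlMr//.
  by rewrite truncn_le.
apply: le_lt_trans (mdist_iter_le _ _ _ (ltW L0) LF) _.
apply: lt_le_trans Lnd; apply: (@le_lt_trans _ _ (L ^+ i * d)).
  by rewrite ler_pM2l// exprn_gt0.
by rewrite ltr_pM2r// ltr_eXn2l.
Qed.

(** Removes the losses in rate, letting [h] tend to [H] and [th] to 1. For [ga > 0] an infinite [H]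
    forces an infinite [D]. *)
Lemma mule_le_approx (R : realType) (ga : R) (H D : \bar R) :
  0 <= ga -> (0 <= H)%E -> (0 <= D)%E ->
  (forall th h, 0 < th -> th < 1 -> 0 < h -> (h%:E < H)%E ->
     ((th * ga * h)%:E <= D)%E) ->
  (ga%:E * H <= D)%E.
Proof.
rewrite le_eqVlt => /predU1P[<-|ga0]; first by rewrite mul0e.
case: D => [d| |] H0 D0 P //; last by rewrite leey.
case: H H0 P => [r| |]// r0 P; last first.
  rewrite lee_fin in D0.
  have d1 : 0 < d + 1 by rewrite ltr_wpDl.
  have i0 : 0 < 1 / 2 :> R by clear; lra.
  have i1 : 1 / 2 < 1 :> R by clear; lra.
  have hp : 0 < 2 * (d + 1) / ga by rewrite !divr_gt0 ?mulr_gt0.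
  have := P _ _ i0 i1 hp (ltry _).
  have -> : 1 / 2 * ga * (2 * (d + 1) / ga) = d + 1.
    by field; rewrite gt_eqF.
  by rewrite lee_fin gerDl ler10.
move: r0; rewrite lee_fin le_eqVlt => /predU1P[<-|r0]; first by rewrite mule0.
rewrite -EFinM lee_fin leNgt; apply/negP => lt.
rewrite lee_fin in D0.
have gr : 0 < ga * r by rewrite mulr_gt0.
pose q := d / (ga * r).
have q0 : 0 <= q by rewrite divr_ge0// ltW.
have q1 : q < 1 by rewrite ltr_pdivrMr// mul1r.
(* Taking [h = th * r] would give [th ^+ 2 <= q], whereas the square of [(1 + q) / 2] exceeds [q]
   when [q < 1]. *)
pose th := (1 + q) / 2.
have th0 : 0 < th by rewrite /th; move: q0; clear; lra.
have th1 : th < 1 by rewrite /th; move: q1; clear; lra.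
have := P th (th * r) th0 th1 (mulr_gt0 th0 r0).
rewrite lte_fin gtr_pMl// => /(_ th1); rewrite lee_fin.
rewrite (_ : th * ga * (th * r) = th ^+ 2 * (ga * r)); last by ring.
rewrite -ler_pdivlMr// -/q /th; move: q1; clear; nra.
Qed.

(** * Maps of zero entropy and trivial cases *)

Lemma htop_eq0 (R : realType) (X : metricType R) (f : X -> X) :
  (forall eps : R, 0 < eps -> exists k, forall n, exists x : nat -> X,
     forall y, exists2 i, (i < k)%N & bowen_ball n (x i) eps f y) ->
  htop f [set: X] = 0%E.
Proof.
move=> cov; apply/eqP; rewrite eq_le htop_ge0 andbT leNgt; apply/negP => hgt.
have [h h0 hlt] : exists2 h : R, 0 < h & (h%:E < htop f [set: X])%E.
  move: hgt; case: (htop _ _) => [r| |]//; last by exists 1; rewrite ?ltry.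
  by rewrite lte_fin => r0; exists (r / 2);
    rewrite ?lte_fin; move: r0; clear; lra.
have [eps [M [m [eps0 m0 mle]]]] := htop_gt_bowen_outer (ltW h0) hlt.
have [k kP] := cov _ eps0.
(* At this length [k] Bowen balls have a sum below [m], so they cannot cover. *)
pose n := maxn M (Num.truncn (ln (k.+1%:R / m) / h)).+1.
have [x xP] := kP n.
have [|y yP] := @uncovered_point _ _ f h eps m M n k x mle (leq_maxl _ _).
  apply: (@lt_le_trans _ _ (k.+1%:R * expR (- h * n%:R))).
    by rewrite ltr_pM2r ?expR_gt0// ltr_nat.
  rewrite -ler_pdivlMl ?ltr0n// -[leRHS]lnK ?posrE ?mulr_gt0 ?invr_gt0 ?ltr0n//.
  rewrite ler_expR mulNr lerNl mulrC -lnV ?posrE ?divr_gt0 ?ltr0n// invf_div.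
  rewrite [leRHS]mulrC -ler_pdivrMr//; apply: le_trans (ltW (truncnS_gt _)) _.
  by rewrite ler_nat leq_maxr.
by have [i ik /(yP _ ik)] := xP y.
Qed.

(** Otherwise points chosen greedily would stay [eps] apart and yet have a cluster point. *)
Lemma compact_net (R : realType) (X : metricType R) (x0 : X) (eps : R) :
  compact [set: X] -> 0 < eps ->
  exists k (x : nat -> X), forall y, exists2 i, (i < k)%N & mdist (x i) y < eps.
Proof.
move=> cX eps0; apply: contrapT => nonet.
have /choice[nxt nxtP] : forall p : seq X, exists y,
    forall w, w \in p -> eps <= mdist w y.
  move=> p; apply: contrapT => /forallNP cov; apply: nonet.
  exists (size p), (nth x0 p) => y.
  have /existsNP[w /not_implyP[wp /negP]] := cov y; rewrite -ltNge => wy.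
  by exists (index w p); rewrite ?index_mem ?nth_index.
pose P n := iter n (fun p => rcons p (nxt p)) [::].
pose v n := nxt (P n).
have vP m n : (m < n)%N -> eps <= mdist (v m) (v n).
  move=> mn; apply: nxtP; elim: n mn => // n IH.
  rewrite ltnS leq_eqVlt => /predU1P[->|/IH vn] /=.
    by rewrite mem_rcons inE eqxx.
  by rewrite mem_rcons inE vn orbT.
have [|v0 [_ clv]] := cX (v @ \oo) _; first by exists 0%N.
have near0 : nbhs v0 (ball v0 (eps / 2)).
  by apply: nbhsx_ballx; rewrite divr_gt0.
have tail n0 : (v @ \oo) (v @` [set n | (n0 <= n)%N]).
  by exists n0 => // n /= n0n; exists n.
have [_ [[m _ <-]]] := clv _ _ (tail 0%N) near0.
have [_ [[n /= mn <-]]] := clv _ _ (tail m.+1) near0.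
rewrite !ballEmdist/= => vn vm.
have := vP _ _ mn; rewrite leNgt => /negP; apply.
apply: le_lt_trans (metric_triangle _ v0 _) _.
by rewrite (splitr eps) metric_sym ltrD.
Qed.

(** One finite net provides the centres of Bowen balls of every length. *)
Lemma htop_nonexpanding (R : realType) (X : metricType R) (x0 : X)
    (f : X -> X) :
  compact [set: X] -> (forall x y, mdist (f x) (f y) <= mdist x y) ->
  htop f [set: X] = 0%E.
Proof.
move=> cX f1; apply: htop_eq0 => eps eps0.
have [k [x xP]] := compact_net x0 cX eps0; exists k => n; exists x => y.
have [i ik xy] := xP y; exists i => // j _; apply: le_lt_trans xy.
have f1' a b : mdist (f a) (f b) <= 1 * mdist a b by rewrite mul1r.
by have := mdist_iter_le j (x i) y ler01 f1'; rewrite expr1n mul1r.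
Qed.

(** A net point near [f^n y] stays near when pulled back, so the preimages of a net under [f^n]
    serve as centres. *)
Lemma htop_nonexpanding_inverse (R : realType) (X : metricType R) (x0 : X)
    (f fi : X -> X) :
  compact [set: X] -> cancel f fi -> cancel fi f ->
  (forall x y, mdist (fi x) (fi y) <= mdist x y) ->
  htop f [set: X] = 0%E.
Proof.
move=> cX fK fiK fi1; apply: htop_eq0 => eps eps0.
have [k [x xP]] := compact_net x0 cX eps0; exists k => n.
exists (fun i => iter n fi (x i)) => y.
have [i ik xy] := xP (iter n f y); exists i => // j jn; apply: le_lt_trans xy.
have fi1' a b : mdist (fi a) (fi b) <= 1 * mdist a b by rewrite mul1r.
have := mdist_iter_le (n - j) (x i) (iter n f y) ler01 fi1'.
rewrite expr1n mul1r; congr (mdist _ _ <= _).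
  by rewrite -{2}(subnKC (ltnW jn)) iterD iter_cancel.
by rewrite -{2}(subnK (ltnW jn)) iterD iter_cancel.
Qed.

Lemma upper_rate_ge0 (R : realType) (phi : nat -> R) :
  (forall n, 0 < phi n <= 1) -> (0 <= upper_rate phi)%E.
Proof.
move=> phi01; rewrite /upper_rate /limn_esup limf_esupE.
apply: le_ereal_inf_tmp => _ [V [n0 _ n0V] <-].
apply: (@le_trans _ _ (- (ln (phi n0) / n0%:R))%:E); last first.
  by apply: ereal_sup_ubound; exists n0 => //; apply: n0V => /=.
have /andP[_ phi1] := phi01 n0.
by rewrite lee_fin oppr_ge0 mulr_le0_ge0 ?invr_ge0// ln_le0.
Qed.

Lemma invr_ln_le0 (R : realType) (L : R) : L <= 1 -> (ln L)^-1 <= 0.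
Proof. by move=> L1; rewrite invr_le0 ln_le0. Qed.
Theorem corollary1p4 (R : realType) (X : metricType R) (f : X -> X)
    (Y : set X) (N : nat) (l1 l2 eps0 : R)
    (phi : nat -> nat -> R) (z : nat -> nat -> X) (s : nat -> nat -> nat) :
  dynamical_system f ->
  (exists L : R, lipschitz_with L f) ->
  Y !=set0 -> compact Y -> (0 < N)%N ->
  iter N f @` Y = Y ->
  [set: X] = \bigcup_(l < N) (iter l f @` Y) ->
  0 < l1 -> 0 < l2 -> 0 < eps0 ->
  exp_specification Y (iter N f) (N%:R * l1) (N%:R * l2) eps0 ->
  (forall j, (1 <= j)%N -> forall n, 0 < phi j n <= 1) ->
  (forall j, (1 <= j)%N -> forall i, (0 < s j i)%N) ->
  (forall j, (1 <= j)%N -> s j i @[i --> \oo] --> \oo) ->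
  let tau := ereal_sup [set upper_rate (phi j) | j in [set j | (1 <= j)%N]] in
  (tau < l1%:E)%E ->
  \bigcap_(j >= 1) Ind' f N (z j) (s j) Y !=set0 ->
  let E := \bigcap_(j >= 1)
             shrinking_target f (phi j) (z j) (range (s j)) in
  let c := entropy_factor l1 l2 (fine tau) in
  [/\ E !=set0,
      (c%:E * htop f [set: X] <= htop f E)%E,
      (forall L : R, lipschitz_with L f ->
         (((ln L)^-1 * c)%:E * htop f [set: X] <= hausdorff_dim E)%E) &
      (forall L1 L2 : R, bilipschitz_homeo L1 L2 f ->
         (((ln L1)^-1 + (ln L2)^-1 * c)%:E * htop f [set: X]
            <= hausdorff_dim E)%E)].

Proof.
move=> [cX _ fc] [L0 L0f] Y0 cY N0 gY XY l10 l20 eps00 spec phi01 _ soo tau.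
move=> taul1 [mu muP] E c.
have [L L1 Lf] := lipschitz_ge1 (ex_intro _ L0 L0f).
have tau_ge j : (1 <= j)%N -> (upper_rate (phi j) <= tau)%E.
  by move=> j1; apply: ereal_sup_ubound; exists j.
have tau0 : (0 <= tau)%E.
  exact: le_trans (upper_rate_ge0 (phi01 1%N isT)) (tau_ge 1%N isT).
have tauE : tau = (fine tau)%:E.
  by rewrite fineK// ge0_fin_numE// (lt_trans taul1)// ltry.
have ftau0 : 0 <= fine tau by rewrite fine_ge0.
have ftaul1 : fine tau < l1 by rewrite -lte_fin -tauE.
have c0 : 0 < c by exact: entropy_factor_gt0.
have fam h th : 0 <= h -> h = 0 \/ (h%:E < htop f [set: X])%E ->
    0 < th -> th < 1 ->
    exists (M : nat -> nat) (x : (nat -> nat) -> X) (eps C : R),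
    [/\ [/\ 0 < eps, 0 < C & forall j, (0 < M j)%N],
        forall sg, is_branch M sg -> E (x sg),
        orbit_separation M x f eps (th * c * h) C false &
        forall fi, continuous fi -> cancel f fi ->
          orbit_separation M x fi eps (th * h) C true].
  move=> h0 hlt th0 th1.
  have [|||M [x [eps [C [pos xE fwd bwd]]]]] := @moran_family R X f Y N L l1 l2
    eps0 (fine tau) h th phi z s mu cY Y0 fc N0 L1 Lf gY XY l10 l20 eps00 spec
    _ soo _ ftau0 ftaul1 _ h0 hlt th0 th1.
  - by move=> j j1 n; have /andP[] := phi01 _ j1 n.
  - by move=> j j1; rewrite -tauE tau_ge.
  - by move=> j j1; exact: muP.
  by exists M, x, eps, C.
clearbody c.
split.
(* Non-emptiness uses rate 0, so it holds whatever the entropy; the constant 0 is a branch of every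
   tree. *)
- have [] := fam 0 2^-1 (lexx _) (or_introl erefl); rewrite ?invr_gt0//.
    by rewrite invf_lt1// ltr1n.
  move=> M [x [eps [C [[_ _ M0] xE _ _]]]].
  by exists (x (fun=> 0%N)); apply: xE => j.
- apply: mule_le_approx; rewrite ?htop_ge0 ?(ltW c0)// => th h th0 th1 h0 hlt.
  have [M [x [eps [C [[e0 C0 M0] xE fwd _]]]]] :=
    fam h th (ltW h0) (or_intror hlt) th0 th1.
  exact: htop_ge_separation fwd.
- move=> L' Lf'; have [L'1|L'1] := leP L' 1.
    apply: le_trans (hausdorff_dim_ge0 _).
    by rewrite mule_le0_ge0 ?htop_ge0// lee_fin mulr_le0_ge0 ?invr_ln_le0// ltW.
  have lnL : 0 < ln L' by exact: ln_gt0.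
  have ga0 : 0 < (ln L')^-1 * c by rewrite mulr_gt0 ?invr_gt0.
  apply: mule_le_approx; rewrite ?htop_ge0 ?hausdorff_dim_ge0 ?(ltW ga0)//.
  move=> th h th0 th1 h0 hlt.
  have [M [x [eps [C [[e0 C0 M0] xE fwd _]]]]] :=
    fam h th (ltW h0) (or_intror hlt) th0 th1.
  have r0 : 0 <= th * c * h by rewrite !mulr_ge0// ltW.
  have [C' C'0 sep] :=
    orbit_separation_dist e0 C0 r0 L'1 (lipschitz_withP Lf') fwd.
  have -> : th * ((ln L')^-1 * c) * h = th * c * h / ln L' by ring.
  apply: hausdorff_dim_ge_separation C'0 _ M0 xE _.
    by rewrite divr_gt0// !mulr_gt0.
  by move=> d /sep[J [uJ _ massJ agree]]; exists J.
have [x0 _] := Y0.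
move=> La Lb [fi [[fK fiK] _ fic Lfi Lff]].
have nonexp (F : X -> X) (K : R) : K <= 1 -> lipschitz_with K F ->
    forall x y, mdist (F x) (F y) <= mdist x y.
  move=> K1 KF x y; apply: le_trans (lipschitz_withP KF x y) _.
  by rewrite ler_piMl ?mdist_ge0.
(* If [f] or its inverse does not expand, the entropy is 0 and the bound is trivial. *)
have [La1|La1] := leP La 1.
  rewrite (htop_nonexpanding_inverse x0 cX fK fiK (nonexp _ _ La1 Lfi)) mule0.
  exact: hausdorff_dim_ge0.
have [Lb1|Lb1] := leP Lb 1.
  rewrite (htop_nonexpanding x0 cX (nonexp _ _ Lb1 Lff)) mule0.
  exact: hausdorff_dim_ge0.
have lna : 0 < ln La by exact: ln_gt0.
have lnb : 0 < ln Lb by exact: ln_gt0.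
have ga0 : 0 < (ln La)^-1 + (ln Lb)^-1 * c.
  by rewrite addr_gt0 ?mulr_gt0 ?invr_gt0.
apply: mule_le_approx; rewrite ?htop_ge0 ?hausdorff_dim_ge0 ?(ltW ga0)//.
move=> th h th0 th1 h0 hlt.
have [M [x [eps [C [[e0 C0 M0] xE fwd bwd]]]]] :=
    fam h th (ltW h0) (or_intror hlt) th0 th1.
have r0 : 0 <= th * c * h by rewrite !mulr_ge0// ltW.
have r0' : 0 <= th * h by rewrite !mulr_ge0// ltW.
have [C1 C10 sep1] :=
    orbit_separation_dist e0 C0 r0 Lb1 (lipschitz_withP Lff) fwd.
have [C2 C20 sep2] := orbit_separation_dist e0 C0 r0' La1 (lipschitz_withP Lfi)
  (bwd _ fic fK).
have -> : th * ((ln La)^-1 + (ln Lb)^-1 * c) * h =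
  th * c * h / ln Lb + th * h / ln La by ring.
apply: (hausdorff_dim_ge_separation (mulr_gt0 C10 C20) _ M0 xE) => [|d d0].
  by rewrite addr_gt0// divr_gt0// !mulr_gt0.
have [J1 [uJ1 pJ1 mJ1 aJ1]] := sep1 _ d0.
have [J2 [uJ2 pJ2 mJ2 aJ2]] := sep2 _ d0.
(* Odd and even coordinates are disjoint, so the masses of past and future multiply and the
   exponents add. *)
exists (J1 ++ J2); split.
- rewrite cat_uniq uJ1 uJ2 andbT /=; apply/hasPn => j /pJ2 j2.
  by apply/negP => /pJ1; rewrite j2.
- rewrite big_cat/= powRD; last by rewrite (gt_eqF d0) implybT.
  rewrite mulrACA; apply: ler_pM => //;
    by apply: prodr_ge0 => j _; rewrite invr_ge0 ler0n.
- move=> sg sg' sgM sgM' close j; rewrite mem_cat => /orP[jJ|jJ].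
    exact: aJ1 jJ.
  exact: aJ2 jJ.
Qed.
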